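(* Let $k\ge 2$ be an integer, let $\beta>0$ be a real number and let $1\le p\le k$. Then the limit $c^{(\beta;k,0)}_{p,E}=\lim_{n\to\infty}c^{(\beta;k,0)}_{p,E}(n)$ exists, and is given by $$c^{(\beta;k,0)}_{p,E}=\frac{\int_{\Omega_k} x_p\cdot\left[D_k(x_1,\ldots,x_k)\cdot e^{-\frac{k}{2}(x_1^2+\cdots+x_k^2)}\right]^\beta d^{(k-1)}x}{\int_{\Omega_k}\left[D_k(x_1,\ldots,x_k)\cdot e^{-\frac{k}{2}(x_1^2+\cdots+x_k^2)}\right]^\beta d^{(k-1)}x}.$$
   Context: For a partition $\lambda=(\lambda_1,\lambda_2,\ldots)$ of $n$ (written $\lambda\vdash n$, with $\lambda_i=0$ for $i$ larger than the number of parts), $f^\lambda$ denotes the number of standard Young tableaux of shape $\lambda$. For an integer $k\ge1$, $H(k,0;n)=\{\lambda\vdash n\mid\lambda_{k+1}=0\}$ is the set of partitions of $n$ with at most $k$ parts. For $\beta>0$ and $1\le p\le k$ put $$\lambda^{(\beta;k,0)}_{p,E}(n)=\frac{\sum_{\lambda\in H(k,0;n)}\lambda_{p}\,(f^\lambda)^{\beta}}{\sum_{\lambda\in H(k,0;n)}(f^\lambda)^{\beta}},$$ and define $c^{(\beta;k,0)}_{p,E}(n)$ by the equation $$\lambda^{(\beta;k,0)}_{p,E}(n)=\frac{n}{k}+c^{(\beta;k,0)}_{p,E}(n)\cdot\sqrt n .$$ Further, $\Omega_k=\{(x_1,\ldots,x_k)\in\mathbb{R}^k\mid x_1\ge x_2\ge\cdots\ge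 x_k\text{ and }x_1+\cdots+x_k=0\}$, $D_k(x_1,\ldots,x_k)=\prod_{1\le i<j\le k}(x_i-x_j)$, and $d^{(k-1)}x$ denotes $(k-1)$-dimensional Lebesgue measure on the hyperplane $x_1+\cdots+x_k=0$ (e.g. $dx_1\cdots dx_{k-1}$; the ratio does not depend on the normalization). *)

(* Defs.v *)
From HB Require Import structures.
From mathcomp Require Import all_boot all_order all_algebra.
From mathcomp Require Import all_classical all_reals all_analysis.

Set Implicit Arguments.
Unset Strict Implicit.
Unset Printing Implicit Defensive.

Import Order.TTheory GRing.Theory Num.Theory.
Import numFieldNormedType.Exports.

Local Open Scope classical_set_scope.
Local Open Scope ring_scope.

(** Partitions and standard Young tableaux *)

(* A partition of n has at most n parts, each at most n: it is encoded by the
   n-tuple of its parts padded with zeros. Indices start at 0, so that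
   [part l i] is the part usually written lambda_(i+1); it is 0 for i >= n. *)
Definition part n (l : n.-tuple 'I_n.+1) (i : nat) : nat :=
  nth 0%N [seq val j | j <- l] i.

Definition is_partition n (l : n.-tuple 'I_n.+1) : bool :=
  sorted geq [seq val j | j <- l] && (\sum_(i < n) part l i == n)%N.

(* H(k, 0; n): the partitions of n with lambda_(k+1) = 0. *)
Definition H_k0 k n : {set n.-tuple 'I_n.+1} :=
  [set l | is_partition l & part l k == 0%N]%SET.

(* The cells (row, column) of the Young diagram of l. *)
Definition cell n (l : n.-tuple 'I_n.+1) : finType :=
  {c : 'I_n * 'I_n | (c.2 < part l c.1)%N}.

(* Entries are taken in {0, ..., n-1} instead of {1, ..., n}. The diagram of a
   partition of n has n cells, so an injective filling uses every entry once. *)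
Definition standard n (l : n.-tuple 'I_n.+1) (t : {ffun cell l -> 'I_n}) :=
  [&& injectiveb t,
      [forall c : cell l, forall d : cell l, ((val c).1 == (val d).1) &&
         ((val c).2 < (val d).2)%N ==> (t c < t d)%N]
    & [forall c : cell l, forall d : cell l, ((val c).2 == (val d).2) &&
         ((val c).1 < (val d).1)%N ==> (t c < t d)%N]].

Definition num_syt n (l : n.-tuple 'I_n.+1) : nat :=
  #|[set t : {ffun cell l -> 'I_n} | standard t]%SET|.

Section expected_shape.
Context {R : realType}.
Variables (beta : R) (k p n : nat).

(* As in [part], p is 0-based. *)
Definition lambdaE : R :=
  (\sum_(l in H_k0 k n) (part l p)%:R * (num_syt l)%:R `^ beta) /
  (\sum_(l in H_k0 k n) (num_syt l)%:R `^ beta).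

(* The value at n = 0 is meaningless (division by 0 yields 0). *)
Definition cE : R := (lambdaE - n%:R / k%:R) / Num.sqrt n%:R.

End expected_shape.

(** Lebesgue measure on R^m and on the hyperplane x_1 + ... + x_k = 0 *)

Section image_measure.
Context d1 d2 (T1 : measurableType d1) (T2 : measurableType d2) (R : realType).
Variables (mu : {measure set T1 -> \bar R}) (f : T1 -> T2).
Hypothesis mf : measurable_fun [set: T1] f.

Definition image_measure of measurable_fun [set: T1] f := pushforward mu f.

Let image0 : image_measure mf set0 = 0%E.
Proof. exact: measure0. Qed.

Let image_ge0 A : (0 <= image_measure mf A)%E.
Proof. exact: measure_ge0. Qed.

Let image_sigma_additive : semi_sigma_additive (image_measure mf).
Proof. exact: measure_semi_sigma_additive. Qed.

HB.instance Definition _ := isMeasure.Build _ _ _ (image_measure mf)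
  image0 image_ge0 image_sigma_additive.

End image_measure.

(* The library proves this inside a section; the instance it declares cannot be
   inferred, being shadowed by the one for subprobabilities. *)
Lemma product_measure_sigma_finite d1 d2 (T1 : measurableType d1)
    (T2 : measurableType d2) (R : realType)
    (m1 : {sigma_finite_measure set T1 -> \bar R})
    (m2 : {sigma_finite_measure set T2 -> \bar R}) :
  sigma_finite setT (m1 \x m2)%E.
Proof.
have /sigma_finiteP[F [TF ndF Foo]] := sigma_finiteT m1.
have /sigma_finiteP[G [TG ndG Goo]] := sigma_finiteT m2.
exists (fun n => F n `*` G n).
  rewrite -setXTT TF TG predeqE => -[x y]; split.
    move=> [/= [n _ Fnx] [k _ Gky]]; exists (maxn n k) => //; split.
    - by move: x Fnx; exact/subsetPset/ndF/leq_maxl.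
    - by move: y Gky; exact/subsetPset/ndG/leq_maxr.
  by move=> [n _ []/= ? ?]; split; exists n.
move=> k; have [? ?] := Foo k; have [? ?] := Goo k.
split; first exact: measurableX.
by rewrite product_measure1E// lte_mul_pinfty// ge0_fin_numE.
Qed.

Section lebesgue_tuple.
Variable R : realType.
Local Notation RT := (measurableTypeR R).

Definition cons_pair m (z : RT * m.-tuple RT) : m.+1.-tuple RT :=
  [the m.+1.-tuple RT of z.1 :: z.2].

Lemma measurable_cons_pair m : measurable_fun setT (@cons_pair m).
Proof. exact: measurable_cons. Qed.

Section step.
Variables (m : nat) (mu : {sigma_finite_measure set (m.-tuple RT) -> \bar R}).

Definition lebesgue_cons :=
  image_measure (lebesgue_measure \x mu)%E (@measurable_cons_pair m).

HB.instance Definition _ := Measure.on lebesgue_cons.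

Let lebesgue_cons_sigma_finite : sigma_finite setT lebesgue_cons.
Proof.
have [F TF Foo] := product_measure_sigma_finite lebesgue_measure mu.
pose g (x : m.+1.-tuple RT) : RT * m.-tuple RT := (thead x, [tuple of behead x]).
have mg : measurable_fun setT g.
  apply/measurable_fun_pairP; split; first exact: (measurable_tnth ord0).
  exact: measurable_behead.
have gK z : g (cons_pair z) = z.
  by case: z => a t; congr pair; apply: val_inj.
exists (fun i => g @^-1` F i); first by rewrite -preimage_bigcup -TF.
move=> i; have [mFi Fioo] := Foo i; split.
  by rewrite -[X in measurable X]setTI; exact: mg.
rewrite /lebesgue_cons /image_measure /pushforward -comp_preimage.
by rewrite (_ : g \o _ = id)//; apply/funext => z; exact: gK.
Qed.

HB.instance Definition _ := @Measure_isSigmaFinite.Build _ _ _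
  lebesgue_cons lebesgue_cons_sigma_finite.

End step.

(* The m-fold product of the one-dimensional Lebesgue measure, the product on
   R^0 being the unit mass at the empty tuple. *)
Fixpoint lebesgue_tuple m :
    {sigma_finite_measure set (m.-tuple RT) -> \bar R} :=
  match m with
  | 0 => (\d_[tuple])%R
  | m'.+1 => lebesgue_cons (lebesgue_tuple m')
  end.

(* Coordinates (x_1, ..., x_(k-1)) on the hyperplane x_1 + ... + x_k = 0. *)
Definition hyperplane_pt k (y : k.-1.-tuple RT) : k.-tuple RT :=
  [tuple if insub (val i) is Some j then tnth y j
         else - \sum_(j < k.-1) tnth y j | i < k].

Lemma measurable_hyperplane_pt k : measurable_fun setT (@hyperplane_pt k).
Proof.
apply/measurable_fun_tnthP => i.
rewrite (_ : _ \o _ = fun y : k.-1.-tuple RT =>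
    if insub (val i) is Some j then tnth y j
    else - \sum_(j < k.-1) tnth y j); last first.
  by apply/funext => y; rewrite /= tnth_mktuple.
case: insubP => [j _ _|_]; first exact: measurable_tnth.
apply: (@measurableT_comp _ _ _ _ _ _ (-%R : RT -> RT)) => //.
by apply: measurable_sum => j; exact: measurable_tnth.
Qed.

(* The measure dx_1 ... dx_(k-1) carried by the hyperplane. *)
Definition lebesgue_hyperplane k : {measure set (k.-tuple RT) -> \bar R} :=
  image_measure (lebesgue_tuple k.-1) (@measurable_hyperplane_pt k).

End lebesgue_tuple.

Section limit_density.
Context {R : realType} {k : nat}.

Definition Omega : set (k.-tuple (measurableTypeR R)) :=
  [set x | (forall i j : 'I_k, (i <= j)%N -> tnth x j <= tnth x i :> R) /\
           \sum_(i < k) tnth x i = 0 :> R].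

Definition Dk (x : k.-tuple (measurableTypeR R)) : R :=
  \prod_(i < k) \prod_(j < k | (i < j)%N) (tnth x i - tnth x j).

Definition weight (beta : R) (x : k.-tuple (measurableTypeR R)) : R :=
  (Dk x * expR (- (k%:R / 2) * \sum_(i < k) (tnth x i : R) ^+ 2)) `^ beta.

End limit_density.

(* Main.v *)
Require Import Defs.
From mathcomp Require Import all_boot all_order all_algebra perm.
From mathcomp Require Import all_classical all_reals all_analysis.
From mathcomp Require Import measurable_realfun.
From mathcomp Require Import zify ring lra.

(** Number the parts from 1 and put l_i = lambda_i + k - i. By the Frobenius
    formula [num_syt_frobenius], f^lambda is n! times the product of the
    differences l_i - l_j (i < j) divided by the product of the l_i!. With
    m = floor(n / k), and because the sum of the l_i depends on n only,
    f^lambda is, up to a factor that depends on n only, the product of the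
    (l_i - l_j) / sqrt n and of the inverses of the ratios
    l_i! m^m / (m! m^(l_i)) ([normalized_sytE]). That factor cancels in the
    quotient which defines the expected part. If
    lambda_i = n / k + x_i sqrt n + O(1), the product over j <= d of the
    1 + j / m, enclosed between exponentials, shows that the i-th ratio tends
    to exp (k x_i^2 / 2). So the normalized number of tableaux tends to
    D_k(x) exp (- k/2 (x_1^2 + ... + x_k^2)) ([normalized_syt_cvg]).

    A partition with at most k parts of a given n is determined by its first
    k - 1 parts. Attach to it the cube of side 1 / sqrt n in R^(k-1) whose
    lowest corner has coordinates (lambda_i - n / k) / sqrt n for i < k. These
    cubes are disjoint, so a sum over partitions is, up to the volume of a
    cube, the integral of a function that is constant on each of them. Such a
    step function tends pointwise to x_p^q times the limit density on Omega
    and to 0 elsewhere ([step_density_cvg]): in the interior of Omega rounding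
    a point of the hyperplane gives a partition as soon as n is large, outside
    it does not, and on the walls the density vanishes in the limit anyway.
    All step functions lie below a multiple of exp (- (|y_1| + ... +
    |y_(k-1)|)) ([step_density_bound]), since the ratios of factorials are at
    least of Gaussian size ([factratio_lower]). Dominated convergence turns
    the sums into integrals ([riemann_sum_cvg]); c_p(n) is the quotient of the
    sums for q = 1 and q = 0 ([cE_ratio]), and the integral for q = 0 is not
    zero because the density is positive on a cube ([limit_moment0_neq0]).

    The Frobenius formula is proved by induction on n. A standard filling is
    determined by the cell of its largest entry, which is a corner of the
    shape, and by the filling that remains; the right-hand side obeys the same
    recursion because the sum of the x_i V(x - e_i) equals
    (x_1 + ... + x_k - k(k-1)/2) V(x) for V the product of the differences of
    the x_i ([diffprod_branching]). *)
Set Implicit Arguments.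
Unset Strict Implicit.
Unset Printing Implicit Defensive.

Import Order.TTheory GRing.Theory Num.Theory.
Import numFieldNormedType.Exports.

Local Open Scope ring_scope.

(** * Linear extensions of a finite relation *)
Section linear_extensions.
Variables (T : finType) (r : rel T) (M : nat).
Implicit Types (A : {set T}) (c d : T) (t : {ffun T -> 'I_M.+1}).
Local Open Scope nat_scope.

(** A filling lives on the whole of T, vanishes outside A and numbers A from 1
    to #|A|. So the fillings of all the subsets A have one type, and to erase a
    cell is to change one value to 0. *)
Definition linext A : {set {ffun T -> 'I_M.+1}} :=
  [set t : {ffun T -> 'I_M.+1} |
    [&& [forall c, (0 < t c) == (c \in A)], [forall c, t c <= #|A|],
        [forall c in A, forall d in A, (t c == t d) ==> (c == d)]
      & [forall c in A, forall d in A, r c d ==> (t c < t d)]]].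

Lemma linextP A t :
  reflect [/\ forall c, (0 < t c) = (c \in A), forall c, t c <= #|A|,
              {in A &, injective t}
            & {in A &, forall c d, r c d -> t c < t d}]
          (t \in linext A).
Proof.
rewrite inE; apply: (iffP and4P) => [[/forallP p0 /forallP p1 p2 p3]|[p0 p1 p2 p3]].
  split=> [c||c d cA dA e|c d cA dA rcd]; [exact: (eqP (p0 c)) | exact: p1 | |].
    have /forallP/(_ d) := implyP (forallP p2 c) cA.
    by rewrite dA e eqxx => /eqP.
  by have /forallP/(_ d) := implyP (forallP p3 c) cA; rewrite dA rcd.
split.
- by apply/forallP => c; rewrite p0.
- exact/forallP.
- apply/forallP => c; apply/implyP => cA; apply/forallP => d; apply/implyP => dA.
  by apply/implyP => /eqP/p2 ->.
- apply/forallP => c; apply/implyP => cA; apply/forallP => d; apply/implyP => dA.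
  by apply/implyP => /p3; apply.
Qed.

Definition maximal A c := (c \in A) && [forall d in A, ~~ r c d].

(** An injection of A into 1, ..., #|A| is onto. Summing over the cell with the
    largest entry therefore sorts the fillings of A. *)
Lemma linext_top A t : A != finset.set0 -> t \in linext A ->
  \sum_(c in A) (val (t c) == #|A| :> nat) = 1.
Proof.
move=> A0 /linextP[tA tM tI _].
have A1 : 0 < #|A| by rewrite card_gt0.
have AM : #|A| < M.+1.
  have sub : t @: A \subset [set~ ord0].
    by apply/fintype.subsetP => _ /imsetP[c cA ->]; rewrite !inE -val_eqE /= -lt0n tA.
  move: (subset_leq_card sub); rewrite card_in_imset// cardsC1 card_ord.
  by rewrite ltnS.
pose a : 'I_M.+1 := Ordinal AM.
have : a \in t @: A.
  have sub : t @: A \subset [set i : 'I_M.+1 | 0 < i <= #|A|].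
    by apply/fintype.subsetP => _ /imsetP[c cA ->]; rewrite inE tA cA tM.
  have /eqP -> : t @: A == [set i : 'I_M.+1 | 0 < i <= #|A|].
    rewrite eqEcard sub card_in_imset//.
    have sub' : [set i : 'I_M.+1 | 0 < i <= #|A|] \subset
        [set inord (val i).+1 | i : 'I_#|A|].
      apply/fintype.subsetP => i; rewrite inE => /andP[i0 iA]; apply/imsetP.
      have iA' : i.-1 < #|A| by rewrite prednK.
      by exists (Ordinal iA') => //; apply/val_inj; rewrite /= prednK// inordK.
    apply: leq_trans (subset_leq_card sub') (leq_trans (leq_imset_card _ _) _).
    by rewrite card_ord.
  by rewrite inE /= A1 leqnn.
case/imsetP => c cA ac; rewrite (bigD1 c)//= -ac eqxx big1// => d /andP[dA dc].
case: eqP => // e; case/eqP: dc; apply: tI => //; rewrite -ac.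
exact/val_inj.
Qed.

(** A cell with the largest entry has no successor, and erasing the entry leaves
    a filling of the rest; conversely, a maximal cell can receive a new largest
    entry whatever the filling of the rest. *)
Lemma card_linext_top A c : #|A| <= M -> c \in A ->
  \sum_(t in linext A) (val (t c) == #|A| :> nat) =
  if maximal A c then #|linext (A :\ c)| else 0.
Proof.
move=> AM cA; have cA1 := cardsD1 c A; rewrite cA add1n in cA1.
case: ifPn => [/andP[_ /forallP cmax]|nmax]; last first.
  rewrite big1// => t /linextP[_ tM _ tr]; case: eqP => // tc.
  case/negP: nmax; rewrite /maximal cA; apply/forallP => d; apply/implyP => dA.
  by apply/negP => /(tr _ _ cA dA); rewrite tc ltnNge tM.
rewrite -big_mkcondr /= sum1dep_card.
pose up t : {ffun T -> 'I_M.+1} :=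
  [ffun d => if d == c then inord #|A| else t d].
pose dn t : {ffun T -> 'I_M.+1} := [ffun d => if d == c then ord0 else t d].
have upP t : t \in linext (A :\ c) -> up t \in linext A /\ val (up t c) = #|A|.
  case/linextP => tA tM tI tr.
  have tcE d : (up t d : nat) = if d == c then #|A| else t d.
    by rewrite ffunE; case: eqP => // _; rewrite inordK.
  split; last by rewrite /= tcE eqxx.
  have tlt d : t d < #|A| by rewrite cA1 ltnS.
  apply/linextP; split.
  - move=> d; rewrite tcE; case: eqP => [->|/eqP dc]; first by rewrite cA cA1.
    by rewrite tA !inE dc.
  - by move=> d; rewrite tcE; case: eqP => // _; exact/ltnW/tlt.
  - move=> d e dA eA /(congr1 val)/=; rewrite !tcE.
    case: eqP => [->|/eqP dc]; case: eqP => [->|/eqP ec] //.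
    + by move=> h; have := tlt e; rewrite -h ltnn.
    + by move=> h; have := tlt d; rewrite h ltnn.
    + by move=> /val_inj; apply: tI; rewrite !inE ?dc ?ec.
  - move=> d e dA eA rde; rewrite !tcE.
    case: eqP => [dc|/eqP dc].
      by move: (cmax e); rewrite eA -dc rde.
    case: eqP => [_|/eqP ec]; first exact: tlt.
    by apply: tr => //; rewrite !inE ?dc ?ec.
have dnP t : t \in linext A -> val (t c) = #|A| -> dn t \in linext (A :\ c).
  case/linextP => tA tM tI tr tc.
  have tlt d : d != c -> t d <= #|A :\ c|.
    move=> dc; case dA : (d \in A); last first.
      by move: (tA d); rewrite dA; case: (val (t d)).
    rewrite -ltnS -cA1 ltn_neqAle tM andbT; apply: contra dc => /eqP h.
    by apply/eqP/tI => //; apply/val_inj; rewrite /= h; exact/esym.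
  apply/linextP; split.
  - by move=> d; rewrite ffunE !inE; case: eqP => //=; rewrite tA.
  - by move=> d; rewrite ffunE; case: eqP => // /eqP/tlt.
  - move=> d e; rewrite !inE !ffunE => /andP[/negbTE-> dA] /andP[/negbTE-> eA].
    exact: tI.
  - move=> d e; rewrite !inE !ffunE => /andP[/negbTE-> dA] /andP[/negbTE-> eA].
    exact: tr.
rewrite -(card_in_imset (f := dn)); last first.
  move=> t u; rewrite !inE => /andP[_ /eqP tc] /andP[_ /eqP uc] e.
  apply/ffunP => d; case: (eqVneq d c) => [->|dc].
    by apply/val_inj; exact: (etrans tc (esym uc)).
  by move/ffunP: e => /(_ d); rewrite !ffunE (negbTE dc).
apply: eq_card => u; apply/imsetP/idP => [[t]|uA].
  by rewrite inE => /andP[tA /eqP tc] ->; exact: dnP.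
have [h1 h2] := upP _ uA; exists (up u).
  by rewrite inE h1 h2 eqxx.
apply/ffunP => d; rewrite !ffunE; case: eqP => // ->.
apply/val_inj; case/linextP : uA => /(_ c); rewrite !inE eqxx /= => h _ _ _.
by case: (val (u c)) h.
Qed.

Lemma card_linext_rec A : #|A| <= M -> A != finset.set0 ->
  #|linext A| = \sum_(c | maximal A c) #|linext (A :\ c)|.
Proof.
move=> AM A0; rewrite -sum1_card.
under eq_bigr => t tA do rewrite -(linext_top A0 tA).
rewrite exchange_big /=.
under eq_bigr => c cA do rewrite card_linext_top//.
rewrite -big_mkcondr /=; apply: eq_bigl => c.
by rewrite /maximal andbA andbb.
Qed.

Lemma card_linext0 : #|linext finset.set0| = 1.
Proof.
apply/eqP/cards1P; exists [ffun=> ord0]; apply/setP => t; rewrite finset.in_set1.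
apply/linextP/eqP => [[t0 _ _ _]|->].
  apply/ffunP => c; apply/val_inj; rewrite ffunE /=.
  by move: (t0 c); rewrite inE; case: (val (t c)).
by split=> c; rewrite ?ffunE ?inE.
Qed.

End linear_extensions.

(** * The branching identity for products of differences *)
Section falling_vandermonde.
Variables (R : comUnitRingType) (k : nat).
Implicit Types x : 'I_k -> R.

Definition diffprod x : R := \prod_(i < k) \prod_(j < k | (i < j)%N) (x i - x j).

Definition fallmx x : 'M[R]_k := \matrix_(i, j) \prod_(t < j) (x i - t%:R).

(** The falling factorials are monic of degrees 0, ..., k - 1, so they come from
    the powers by a unitriangular change of basis, and the determinant is that
    of Vandermonde. *)
Lemma det_fallmx x :
  \det (fallmx x) = \prod_(i < k) \prod_(j < k | (i < j)%N) (x j - x i).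
Proof.
pose p (j : nat) : {poly R} := \prod_(t < j) ('X - t%:R%:P).
have pm j : p j \is monic by exact: monic_prod_XsubC.
have ps j : size (p j) = j.+1.
  rewrite /p -(big_mkord xpredT (fun t => 'X - t%:R%:P)).
  by rewrite size_prod_XsubC size_iota subn0.
pose C : 'M[R]_k := \matrix_(j, m) (p j)`_m.
have -> : fallmx x = (C *m Vandermonde k (\row_i x i))^T.
  apply/matrixP => i j; rewrite !mxE.
  transitivity (p j).[x i].
    by rewrite horner_prod; apply: eq_bigr => t _; rewrite hornerXsubC.
  rewrite (@horner_coef_wide _ k) ?ps//.
  by apply: eq_bigr => m _; rewrite !mxE.
rewrite det_tr det_mulmx det_Vandermonde det_trig.
  rewrite big1 ?mul1r.
    by apply: eq_bigr => i _; apply: eq_bigr => j _; rewrite !mxE.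
  move=> i _; rewrite !mxE; have /monicP := pm i.
  by rewrite lead_coefE ps.
apply/is_trig_mxP => i j ij; rewrite mxE nth_default// ps; exact: ij.
Qed.

(** The sign s depends on k only, so it drops out of identities that are
    homogeneous in the product of differences. *)
Lemma diffprodE : exists s : R, forall x, diffprod x = s * \det (fallmx x).
Proof.
exists (\prod_(i < k) \prod_(j < k | (i < j)%N) (-1)) => x.
rewrite det_fallmx -big_split /=; apply: eq_bigr => i _.
by rewrite -big_split /=; apply: eq_bigr => j _; rewrite mulN1r opprB.
Qed.

(** Expand by Leibniz's formula. In the term of a permutation s, the row of x_i
    contributes a falling factorial of length s i. Shifting x_i by one and
    multiplying by x_i makes it one factor longer, that is, multiplies the term
    by x_i - s i; and the s i run through 0, ..., k - 1. *)
Lemma det_fallmx_branching x :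
  \sum_(i < k) x i * \det (fallmx (fun j => x j - (j == i)%:R)) =
  (\sum_(i < k) x i - \sum_(i < k) (i : nat)%:R) * \det (fallmx x).
Proof.
rewrite /determinant mulr_sumr.
under eq_bigr => i _ do rewrite mulr_sumr.
rewrite exchange_big /=; apply: eq_bigr => s _.
rewrite [in RHS]mulrCA; under eq_bigr => i _ do rewrite mulrCA.
rewrite -mulr_sumr; congr (_ * _).
rewrite [X in _ - X](reindex_inj (@perm_inj _ s)) /= -sumrB mulr_suml.
apply: eq_bigr => i _; rewrite (bigD1 i)//= [in RHS](bigD1 i)//= mulrA mulrA.
congr (_ * _); last first.
  apply: eq_bigr => j ji; rewrite !mxE; apply: eq_bigr => t _.
  by rewrite (negbTE ji) subr0.
rewrite !mxE eqxx -[LHS]/(x i * _).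
have -> : x i * \prod_(t < s i) (x i - 1 - t%:R) = \prod_(t < (s i).+1) (x i - t%:R).
  rewrite big_ord_recl subr0; congr (_ * _); apply: eq_bigr => t _.
  by rewrite /= /bump /= add1n -natr1; ring.
by rewrite big_ord_recr /= mulrC.
Qed.

Lemma diffprod_branching x :
  \sum_(i < k) x i * diffprod (fun j => x j - (j == i)%:R) =
  (\sum_(i < k) x i - \sum_(i < k) (i : nat)%:R) * diffprod x.
Proof.
have [s sE] := diffprodE; rewrite sE mulrCA -det_fallmx_branching mulr_sumr.
by apply: eq_bigr => i _; rewrite sE mulrCA.
Qed.

End falling_vandermonde.

(** * Young diagrams and the Frobenius formula *)
Lemma leq_nonincreasing (s : nat -> nat) :
  (forall i, s i.+1 <= s i)%N -> forall a b, (a <= b)%N -> (s b <= s a)%N.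
Proof.
move=> smono a b; elim: b => [|b IHb]; first by case: a.
rewrite leq_eqVlt ltnS => /orP[/eqP->//|/IHb]; exact: leq_trans.
Qed.
Section diagrams.
Local Open Scope nat_scope.
Variable N : nat.
Implicit Types (s : nat -> nat) (c d : 'I_N * 'I_N).

Definition cellrel : rel ('I_N * 'I_N) := fun c d =>
  ((c.1 == d.1) && (c.2 < d.2)) || ((c.2 == d.2) && (c.1 < d.1)).

Definition diag s : {set 'I_N * 'I_N} := [set c : 'I_N * 'I_N | c.2 < s c.1].

Definition remove_cell i s : nat -> nat := fun j => s j - (j == i).

Lemma card_diag s : (forall i, s i <= N) -> #|diag s| = \sum_(i < N) s i.
Proof.
move=> sN; rewrite -sum1dep_card.
rewrite -(pair_big_dep xpredT (fun i j : 'I_N => j < s i) (fun=> fun=> 1))/=.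
apply: eq_bigr => i _; rewrite sum1dep_card.
have -> : [set j : 'I_N | j < s i] = widen_ord (sN i) @: [set: 'I_(s i)].
  apply/setP => j; rewrite inE; apply/idP/imsetP => [ji|[u _ ->]//=].
  by exists (Ordinal ji); rewrite ?inE//; apply/val_inj.
by rewrite card_imset ?cardsT ?card_ord// => u v /(congr1 val)/= /val_inj.
Qed.

Lemma maximal_diag s c : (forall i, s i.+1 <= s i) -> (forall i, s i <= N) ->
    (forall i, N <= i -> s i = 0) ->
  maximal cellrel (diag s) c = (c.2.+1 == s c.1) && (s c.1.+1 < s c.1).
Proof.
move=> smono sN s0; case: c => i j; rewrite /maximal inE /=.
apply/andP/andP => [[js /forallP ijmax]|[/eqP js si]].
  have js' : j.+1 = s i.
    apply/eqP; rewrite eqn_leq js /= leqNgt; apply/negP => js1.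
    have jN : j.+1 < N by exact: leq_trans (sN i).
    by have := ijmax (i, Ordinal jN); rewrite inE /= js1 /cellrel /= eqxx ltnSn.
  rewrite js' eqxx; split => //; rewrite ltnNge -js'; apply/negP => si.
  have iN : i.+1 < N.
    by rewrite ltnNge; apply/negP => /s0 s0i; rewrite s0i in si.
  have := ijmax (Ordinal iN, j); rewrite inE /= /cellrel /= eqxx ltnSn /= orbT.
  by rewrite si.
rewrite -js ltnSn; split => //; apply/forallP => -[i' j']; rewrite inE /=.
apply/implyP => js'; rewrite /cellrel /=; apply/negP => /orP[] /andP[/eqP].
  by move=> ii jj; rewrite -ii in js'; lia.
move=> jj ii; rewrite -jj in js'.
have := leq_nonincreasing smono ii; lia.
Qed.

Lemma diag_remove_cell s c : c.2.+1 = s c.1 -> diag s :\ c = diag (remove_cell c.1 s).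
Proof.
move=> cs; apply/setP => d; rewrite !inE /remove_cell.
case: c d cs => [i j] [i' j'] /= cs; rewrite xpair_eqE.
case: (eqVneq i' i) => [->|ii].
  by rewrite !eqxx subn1 -cs /= ltnS -val_eqE /= -ltn_neqAle.
by rewrite (negbTE (_ : val i' != val i)) ?subn0.
Qed.

End diagrams.

Lemma eq_sum_supp (G : nat -> nat) N k :
    (forall i, N <= i -> G i = 0)%N -> (forall i, k <= i -> G i = 0)%N ->
  (\sum_(i < N) G i = \sum_(i < k) G i)%N.
Proof.
wlog Nk : N k / (N <= k)%N.
  move=> H GN Gk; have /orP[Nk|kN] := leq_total N k; first exact: H.
  by apply/esym/H.
move=> GN Gk; rewrite -!(big_mkord xpredT G) [RHS](@big_cat_nat _ _ _ N)//=.
by rewrite [X in (_ + X)%N]big_nat [X in (_ + X)%N]big1 ?addn0// => i /andP[/GN].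
Qed.

(** This is the Frobenius formula for the empty shape. *)
Lemma diffprod_staircase (R : comUnitRingType) k :
  diffprod (fun i : 'I_k => (k.-1 - i)%:R : R) =
  \prod_(i < k) (k.-1 - i)`!%:R.
Proof.
apply: eq_bigr => i _; have ik := ltn_ord i.
transitivity ((\prod_(j < k | (i < j)%N) (j - i))%N%:R : R).
  rewrite natr_prod; apply: eq_bigr => j ij; have jk := ltn_ord j.
  by rewrite -natrB; [congr (_%:R); lia | lia].
congr (_%:R); rewrite fact_prod.
rewrite -(big_mkord (fun j => i < j)%N (fun j => (j - i)%N)).
rewrite (big_cat_nat (n := i.+1))//= big_nat_cond big1 ?mul1n; last first.
  by move=> j; lia.
rewrite -(add0n i.+1) big_addn big_add1 /= big_nat_cond [RHS]big_nat.
have -> : (k - i.+1 = k.-1 - i)%N by lia.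
rewrite [LHS](eq_bigl (fun j => 0 <= j < k.-1 - i)%N); last by move=> j; lia.
by apply: eq_bigr => j _; lia.
Qed.

Section frobenius.
Variables (R : numFieldType) (k N : nat).
Implicit Types s : nat -> nat.

(** The rows are numbered from 0, so k - 1 - i is the number of rows below row i;
    the beta-numbers of a shape with k rows are the hook lengths of its first
    column. *)
Definition beta_number s (i : nat) : nat := (s i + (k.-1 - i))%N.

(** Both sides obey the same recursion when corners are removed. The branching
    identity sums over all the rows, but a row without a corner contributes
    nothing: either its beta-number is 0, or it exceeds the next one by 1 and
    decreasing it makes two beta-numbers equal. *)
Lemma frobenius_formula s : (forall i, s i.+1 <= s i)%N ->
    (forall i, k <= i -> s i = 0)%N -> (\sum_(i < k) s i <= N)%N ->
  #|linext (@cellrel N) N (diag N s)|%:R * \prod_(i < k) (beta_number s i)`!%:R =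
  (\sum_(i < k) s i)`!%:R * diffprod (fun i : 'I_k => (beta_number s i)%:R) :> R.
Proof.
move Em : (\sum_(i < k) s i)%N => m; elim: m s Em => [|m IH] s Em smono s0 mN.
  have sE i : s i = 0%N.
    have [ik|/s0//] := ltnP i k.
    by move/eqP: Em; rewrite sum_nat_eq0 => /forallP/(_ (Ordinal ik))/eqP.
  have -> : diag N s = finset.set0.
    by apply/setP => c; rewrite !inE sE ltn0.
  rewrite card_linext0 fact0 !mul1r.
  transitivity (\prod_(i < k) (k.-1 - i)`!%:R : R).
    by apply: eq_bigr => i _; rewrite /beta_number sE.
  rewrite -diffprod_staircase; apply: eq_bigr => i _; apply: eq_bigr => j _.
  by rewrite /beta_number !sE.
have smon := leq_nonincreasing smono.
have sle i : (s i <= m.+1)%N.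
  have [ik|/s0->//] := ltnP i k.
  by rewrite -Em (bigD1 (Ordinal ik))//= leq_addr.
have sN i : (s i <= N)%N by exact: leq_trans (sle i) mN.
have s0N i : (N <= i -> s i = 0)%N.
  move=> Ni; apply/eqP; rewrite -leqn0 leqNgt; apply/negP => si.
  have ik : (i < k)%N by rewrite ltnNge; apply/negP => /s0; lia.
  suff : (i.+1 <= m.+1)%N by lia.
  rewrite -Em -(big_mkord xpredT s) (@big_cat_nat _ _ _ i.+1)//=.
  rewrite (leq_trans _ (leq_addr _ _))//.
  rewrite -[X in (X <= _)%N](muln1 i.+1) -[X in (X * _)%N]subn0 -sum_nat_const_nat.
  by rewrite big_nat [leqRHS]big_nat; apply: leq_sum => j /andP[_ ji];
    have := smon j i; lia.
have cardA : #|diag N s| = m.+1 by rewrite card_diag// (eq_sum_supp s0N s0).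
have A0 : diag N s != finset.set0 by rewrite -card_gt0 cardA.
rewrite card_linext_rec ?cardA//.
(* A row with no cell has no corner, so the sum over the N rows of the grid is
   also a sum over k rows. *)
pose G i := if (s i.+1 < s i)%N then #|linext (@cellrel N) N (diag N (remove_cell i s))|
  else 0%N.
have -> : (\sum_(c | maximal (@cellrel N) (diag N s) c)
    #|linext (@cellrel N) N (diag N s :\ c)| = \sum_(i < k) G i)%N.
  rewrite -(@eq_sum_supp G N k); last 2 first.
  - by move=> i /s0N si; rewrite /G si.
  - by move=> i /s0 si; rewrite /G si.
  under eq_bigl => c do rewrite maximal_diag//.
  transitivity (\sum_(c : 'I_N * 'I_N | (c.2.+1 == s c.1) && (s c.1.+1 < s c.1))
      #|linext (@cellrel N) N (diag N (remove_cell c.1 s))|)%N.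
    by apply: eq_bigr => c /andP[/eqP h _]; rewrite diag_remove_cell.
  rewrite -(pair_big_dep xpredT
    (fun i j : 'I_N => (j.+1 == s i) && (s i.+1 < s i))%N
    (fun i _ => #|linext (@cellrel N) N (diag N (remove_cell i s))|)) /=.
  apply: eq_bigr => i _; rewrite /G; case: ifPn => si; last first.
    by rewrite big1// => j /andP[].
  have jN : ((s i).-1 < N)%N by have := sN i; lia.
  rewrite (big_pred1 (Ordinal jN)) => // j /=; rewrite ?si ?andbT.
  by apply/eqP/eqP => [h|->/=]; [apply/val_inj => /=; lia | lia].
(* The beta-numbers of the empty shape are 0, ..., k - 1 in reverse order. *)
have stair : (\sum_(i < k) (beta_number s i)%:R - \sum_(i < k) (i : nat)%:R = m.+1%:R :> R).
  rewrite [X in _ - X](reindex_inj rev_ord_inj) -!natr_sum -natrB; last first.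
    by apply: leq_sum => i _; rewrite /beta_number /=; lia.
  congr (_%:R); rewrite -Em; rewrite /beta_number big_split /=.
  rewrite [X in (_ + X - _)%N](eq_bigr (fun i : 'I_k => (k - i.+1)%N)).
    by rewrite addnK.
  by move=> i _; lia.
rewrite factS natrM [m.+1%:R * _]mulrC -mulrA -stair -diffprod_branching.
rewrite natr_sum mulr_suml mulr_sumr.
apply: eq_bigr => i _; rewrite /G; case: ifPn => si.
  have rE j : beta_number (remove_cell i s) j = (beta_number s j - (j == i))%N.
    rewrite /beta_number /remove_cell; case: eqP => [->|]; lia.
  have ri : (\sum_(j < k) remove_cell i s j = m)%N.
    apply/eqP; rewrite -eqSS -Em (bigD1 i)//= [in eqbRHS](bigD1 i)//= /remove_cell eqxx.
    rewrite (eq_bigr (fun j : 'I_k => s j)); first by apply/eqP; lia.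
    by move=> j /negbTE ji; rewrite (_ : (j == i :> nat) = false)// subn0.
  have := IH (remove_cell i s) ri.
  have -> : diffprod (fun j : 'I_k => (beta_number (remove_cell i s) j)%:R) =
      diffprod (fun j : 'I_k => (beta_number s j)%:R - (j == i)%:R) :> R.
    apply: eq_bigr => a _; apply: eq_bigr => b _.
    have E (j : 'I_k) : (beta_number (remove_cell i s) j)%:R =
        (beta_number s j)%:R - (j == i)%:R :> R.
      rewrite rE natrB //; case: eqP => // ->; rewrite /beta_number; lia.
    by rewrite !E.
  move=> H; rewrite [RHS]mulrCA -H.
  - rewrite [RHS]mulrCA; congr (_ * _); rewrite (bigD1 i)//= [in RHS](bigD1 i)//=.
    rewrite rE eqxx mulrA subn1 -natrM.
    have -> : (beta_number s i)`! = (beta_number s i * (beta_number s i).-1`!)%N.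
      have bi : (0 < beta_number s i)%N by rewrite addn_gt0 (leq_ltn_trans _ si).
      by rewrite -[in LHS](prednK bi) factS prednK.
    congr (_ * _); apply: eq_bigr => j /negbTE ji.
    by rewrite rE (_ : (j == i :> nat) = false)// subn0.
  - move=> j; rewrite /remove_cell; have := smono j.
    by case: (eqVneq j (i : nat)) => [->|_]; case: (j.+1 == i); lia.
  - by move=> j /s0; rewrite /remove_cell => ->.
  - lia.
rewrite mul0r; have [ik|ik] := ltnP i.+1 k; last first.
  rewrite [beta_number _ _](_ : _ = 0)%N ?mul0r ?mulr0//.
  rewrite /beta_number; move: si; rewrite s0//; lia.
have -> : diffprod (fun j : 'I_k => (beta_number s j)%:R - (j == i)%:R) = 0 :> R.
  rewrite /diffprod (bigD1 i)//= (bigD1 (Ordinal ik))//= eqxx.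
  rewrite (_ : (Ordinal ik == i) = false) ?subr0; last by rewrite -val_eqE /=; lia.
  rewrite (_ : beta_number s i = (beta_number s i.+1).+1) ?mulrSr ?add0r ?addrK ?subrr ?mul0r//.
  by have := smono i; rewrite /beta_number; lia.
by rewrite !mulr0.
Qed.

End frobenius.

(** * Standard tableaux of the partitions with at most k parts *)
Section partitions.
Variables (n : nat) (l : n.-tuple 'I_n.+1).
Hypothesis lP : is_partition l.

Lemma part_le i : (part l i <= n)%N.
Proof.
rewrite /part; have [il|li] := ltnP i (size [seq val j | j <- l]).
  rewrite size_map in il; rewrite (nth_map ord0)// -ltnS; exact: ltn_ord.
by rewrite nth_default.
Qed.

Lemma part_default i : (n <= i)%N -> part l i = 0%N.
Proof. by move=> ni; rewrite /part nth_default// size_map size_tuple. Qed.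

Lemma part_nonincreasing i : (part l i.+1 <= part l i)%N.
Proof.
have /andP[ls _] := lP.
have [il|/part_default->//] := ltnP i.+1 n.
have /(sortedP 0%N) := ls; apply.
by rewrite size_map size_tuple.
Qed.

Lemma sum_part : (\sum_(i < n) part l i = n)%N.
Proof. by case/andP: lP => _ /eqP. Qed.

(** Entries move up by one, because 0 marks the cells outside the diagram. *)
Lemma num_syt_linext : num_syt l = #|linext (@cellrel n) n (diag n (part l))|.
Proof.
have cA : #|diag n (part l)| = n by rewrite card_diag ?sum_part//; exact: part_le.
pose up (t : {ffun cell l -> 'I_n}) : {ffun 'I_n * 'I_n -> 'I_n.+1} :=
  [ffun c => if insub c is Some c' then inord (t c').+1 else ord0].
have upE t (c : cell l) : val (up t (val c)) = (t c).+1.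
  by rewrite ffunE valK /= inordK// ltnS.
have up0 t c : c \notin diag n (part l) -> up t c = ord0.
  by rewrite inE => cl; rewrite ffunE insubN.
have cellP (c : cell l) : val c \in diag n (part l) by rewrite inE (valP c).
have liftP c : c \in diag n (part l) -> exists c' : cell l, val c' = c.
  by rewrite inE => cl; exists (exist _ c cl).
rewrite /num_syt -(card_in_imset (f := up)); last first.
  move=> t u _ _ e; apply/ffunP => c; apply/val_inj/succn_inj.
  by rewrite -!upE e.
apply: eq_card => u; apply/imsetP/linextP => [[t]|[uA uM uI ur]].
  rewrite inE => /and3P[/injectiveP ti /forallP t1 /forallP t2] ->; split.
  - move=> c; case: (boolP (c \in _)) => [/liftP[c' <-]|/up0 ->//].
    by have -> : (up t (val c') : nat) = (t c').+1 by exact: upE.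
  - by move=> c; rewrite cA -ltnS; exact: ltn_ord.
  - move=> _ _ /liftP[c <-] /liftP[d <-] /(congr1 val); rewrite !upE.
    by move=> /succn_inj/val_inj/ti ->.
  - move=> _ _ /liftP[c <-] /liftP[d <-] cd.
    suff : ((up t (val c) : nat) < (up t (val d) : nat))%N by [].
    rewrite -![nat_of_ord (up _ _)]/(val _) !upE ltnS.
    case/orP: cd => cd; [have /forallP/(_ d) := t1 c|have /forallP/(_ d) := t2 c];
      by rewrite cd.
pose dn : {ffun cell l -> 'I_n} :=
  [ffun c => insubd (Ordinal (ltn_ord (val c).1)) (u (val c)).-1].
have u0 (c : cell l) : (0 < u (val c))%N by rewrite uA.
have dnE (c : cell l) : (dn c : nat) = (u (val c)).-1.
  have h : ((u (val c)).-1 < n)%N.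
    by have := u0 c; have := ltn_ord (u (val c)); lia.
  by rewrite ffunE /insubd insubT.
exists dn; last first.
  apply/ffunP => c; apply/val_inj; case: (boolP (c \in diag n (part l))) => [/liftP[c' <-]|cN].
    by rewrite upE dnE prednK.
  rewrite up0//; move: (uA c); rewrite (negbTE cN) => /=.
  by case: (nat_of_ord _).
rewrite inE; apply/and3P; split.
- apply/injectiveP => c d /(congr1 (@nat_of_ord n)); rewrite !dnE => e.
  apply/val_inj/uI => //; apply/val_inj.
  by apply: (etrans (esym (prednK (u0 c)))); rewrite e; exact: prednK.
- apply/forallP => c; apply/forallP => d; apply/implyP => cd; rewrite !dnE.
  have : (u (val c) < u (val d))%N by apply: ur => //; rewrite /cellrel cd.
  by have := u0 c; lia.
- apply/forallP => c; apply/forallP => d; apply/implyP => cd; rewrite !dnE.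
  have : (u (val c) < u (val d))%N by apply: ur => //; rewrite /cellrel cd orbT.
  by have := u0 c; lia.
Qed.

End partitions.

Section at_most_k_rows.
Variables (k n : nat) (l : n.-tuple 'I_n.+1).
Hypothesis lH : l \in H_k0 k n.

Lemma H_k0_partition : is_partition l.
Proof. by move: lH; rewrite inE => /andP[]. Qed.

Lemma H_k0_part i : (k <= i)%N -> part l i = 0%N.
Proof.
have [lP lk] : is_partition l /\ part l k = 0%N.
  by move: lH; rewrite inE => /andP[? /eqP].
elim: i => [|i IH]; first by rewrite leqn0 => /eqP k0; rewrite -[in RHS]lk k0.
rewrite leq_eqVlt ltnS => /orP[/eqP<-//|/IH l0].
by apply/eqP; rewrite -leqn0 -l0; exact: (part_nonincreasing lP).
Qed.

Lemma H_k0_sum : (\sum_(i < k) part l i = n)%N.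
Proof.
by rewrite -(eq_sum_supp (part_default l) H_k0_part) (sum_part H_k0_partition).
Qed.

Lemma num_syt_frobenius (R : numFieldType) :
  (num_syt l)%:R * \prod_(i < k) (beta_number k (part l) i)`!%:R =
  n`!%:R * diffprod (fun i : 'I_k => (beta_number k (part l) i)%:R) :> R.
Proof.
have lP := H_k0_partition.
have := @frobenius_formula R k n (part l) (part_nonincreasing lP) H_k0_part.
rewrite H_k0_sum num_syt_linext//; exact.
Qed.

End at_most_k_rows.

Local Open Scope classical_set_scope.
Local Open Scope ring_scope.

(** * Ratios of factorials *)
Section factorial_ratio.
Variable R : realType.
Implicit Types (m l : nat) (K : R).

(** This is l! / (m! m^(l - m)), written so that l may be smaller than m. *)
Definition factratio m l : R := (l`!%:R * m%:R ^+ m) / (m`!%:R * m%:R ^+ l).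

(** With d = l - m this is d (d + 1) / (2 m), which approximates the logarithm of
    [factratio m l]: for d >= 0 it is the sum of the j / m for j <= d, and the
    ratio is the product of the 1 + j / m. *)
Definition quad_dev m l : R := (l%:R - m%:R) * (l%:R - m%:R + 1) / (2 * m%:R).

Lemma factratio_gt0 m l : (0 < m)%N -> 0 < factratio m l.
Proof.
by move=> m0; rewrite divr_gt0// mulr_gt0// ?exprn_gt0// ltr0n// fact_gt0.
Qed.

Lemma factratio_diag m : (0 < m)%N -> factratio m m = 1.
Proof.
move=> m0; rewrite /factratio divff// mulf_neq0 ?expf_neq0 ?pnatr_eq0 -?lt0n//.
exact: fact_gt0.
Qed.

Lemma factratioS m l : (0 < m)%N ->
  factratio m l.+1 = factratio m l * (l.+1%:R / m%:R).
Proof.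
move=> m0; have mR : m%:R != 0 :> R by rewrite pnatr_eq0 -lt0n.
have fR : m`!%:R != 0 :> R by rewrite pnatr_eq0 -lt0n fact_gt0.
rewrite /factratio factS natrM exprS; field.
by rewrite mR fR expf_neq0.
Qed.

Lemma quad_dev_diag m : quad_dev m m = 0.
Proof. by rewrite /quad_dev subrr !mul0r. Qed.

Lemma quad_devS m l : (0 < m)%N -> quad_dev m l.+1 = quad_dev m l + (l.+1%:R / m%:R - 1).
Proof.
move=> m0; have mR : m%:R != 0 :> R by rewrite pnatr_eq0 -lt0n.
rewrite /quad_dev -natr1; field.
by rewrite mR.
Qed.

(** This is 1 - v <= exp (- v) for v = u / (1 + u), inverted. *)
Lemma expR_le1Dx (u : R) : 0 < 1 + u -> expR (u / (1 + u)) <= 1 + u.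
Proof.
move=> u1; have := expR_ge1Dx (- (u / (1 + u))).
have -> : 1 + - (u / (1 + u)) = (1 + u)^-1 by field; exact: lt0r_neq0.
by rewrite expRN lef_pV2 ?posrE ?expR_gt0.
Qed.

(** A step from l to l + 1 multiplies the ratio by 1 + u and adds u to
    [quad_dev], where u = (l + 1 - m) / m. In the four bounds that follow, the
    inequalities exp (u / (1 + u)) <= 1 + u <= exp u are multiplied up or down
    from l = m, where both quantities are trivial; K bounds 1 + u. *)
Lemma factratio_le m l : (0 < m)%N -> (m <= l)%N ->
  factratio m l <= expR (quad_dev m l).
Proof.
move=> m0 /subnK <-; elim: (l - m)%N => [|d IH].
  by rewrite add0n factratio_diag// quad_dev_diag expR0.
rewrite addSn factratioS// quad_devS// expRD ler_pM//.
- exact/ltW/factratio_gt0.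
- by rewrite (le_trans _ (expR_ge1Dx _))// subrKC.
Qed.

Lemma factratio_ge m l K : (0 < m)%N -> (m <= l)%N -> 1 <= K ->
  l%:R <= K * m%:R -> expR (quad_dev m l / K) <= factratio m l.
Proof.
move=> m0 /subnK <- K1; have mR : 0 < m%:R :> R by rewrite ltr0n.
elim: (l - m)%N => [|d IH].
  by rewrite add0n factratio_diag// quad_dev_diag mul0r expR0.
rewrite addSn => lK; rewrite factratioS// quad_devS// mulrDl expRD.
have {}IH : expR (quad_dev m (d + m) / K) <= factratio m (d + m).
  by apply: IH; rewrite (le_trans _ lK)// ler_nat.
rewrite ler_pM ?expR_ge0//.
set v := _ / m%:R; have v0 : 0 < 1 + (v - 1).
  by rewrite subrKC divr_gt0.
have v1 : 1 <= v by rewrite ler_pdivlMr// mul1r ler_nat -addSn leq_addl.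
have := expR_le1Dx v0; rewrite subrKC; apply: le_trans.
rewrite ler_expR ler_wpM2l ?subr_ge0// lef_pV2 ?posrE ?(lt_le_trans ltr01)//.
by rewrite ler_pdivrMr.
Qed.

Lemma downward_ind m (P : nat -> Prop) : P m ->
  (forall l, (l < m)%N -> P l.+1 -> P l) -> forall l, (l <= m)%N -> P l.
Proof.
move=> Pm Pd l lm; rewrite -(subKn lm).
elim: (m - l)%N (leq_subr l m) => [|d IH] dm; first by rewrite subn0.
by apply: Pd; [lia | rewrite -subSn// subSS; apply: IH; lia].
Qed.

Lemma factratio_ge_below m l : (0 < m)%N -> (l <= m)%N ->
  expR (quad_dev m l) <= factratio m l.
Proof.
move=> m0; have mR : 0 < m%:R :> R by rewrite ltr0n.
move: l; apply: downward_ind => [|l lm].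
  by rewrite factratio_diag// quad_dev_diag expR0.
rewrite factratioS// quad_devS// expRD; set v := _ / m%:R => H.
have v0 : 0 < v by rewrite divr_gt0.
rewrite -(ler_pM2r v0) (le_trans _ H)// ler_wpM2l ?expR_ge0//.
by rewrite (le_trans _ (expR_ge1Dx _))// subrKC.
Qed.

Lemma factratio_le_below m l K : (0 < m)%N -> (l <= m)%N -> 0 < K ->
  K * m%:R <= l%:R -> factratio m l <= expR (quad_dev m l / K).
Proof.
move=> m0; have mR : 0 < m%:R :> R by rewrite ltr0n.
move: l; apply: downward_ind => [|l lm].
  by rewrite factratio_diag// quad_dev_diag mul0r expR0.
rewrite factratioS// quad_devS// mulrDl expRD; set v := _ / m%:R => H K0 Kl.
have v0 : 0 < v by rewrite divr_gt0.
have Kv : K <= v.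
  by rewrite ler_pdivlMr// (le_trans Kl)// ler_nat.
have v1 : v <= 1 by rewrite ler_pdivrMr// mul1r ler_nat.
have {}H := H K0 (le_trans Kl _); rewrite -(ler_pM2r v0).
apply: (le_trans (H _)); first by rewrite ler_nat.
rewrite ler_wpM2l ?expR_ge0//.
have : expR ((v - 1) / v) <= v.
  have := @expR_le1Dx (v - 1); rewrite subrKC; exact.
apply: le_trans; rewrite ler_expR -subr_ge0 -mulrBr.
by rewrite mulr_le0// subr_le0// lef_pV2 ?posrE.
Qed.

Lemma quad_dev_ge0 m l : 0 <= quad_dev m l.
Proof.
apply: divr_ge0; last by rewrite mulr_ge0.
have [ml|lm] := leqP m l.
  have d0 : 0 <= l%:R - m%:R :> R by rewrite subr_ge0 ler_nat.
  by rewrite mulr_ge0// addr_ge0.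
rewrite mulr_le0 ?subr_le0 ?ler_nat ?(ltnW lm)//.
by rewrite addrAC natr1 subr_le0 ler_nat.
Qed.

(** A lower bound of Gaussian size, uniform as long as l stays below a fixed
    multiple of m. *)
Lemma factratio_lower m l K : (0 < m)%N -> 1 <= K -> l%:R <= K * m%:R ->
  expR (quad_dev m l / K) <= factratio m l.
Proof.
move=> m0 K1 lK; have [ml|/ltnW lm] := leqP m l; first exact: factratio_ge.
apply: le_trans (factratio_ge_below m0 lm); rewrite ler_expR.
by rewrite ler_pdivrMr ?(lt_le_trans ltr01)// ler_peMr// quad_dev_ge0.
Qed.

(** The two exponentials enclose the ratio, in one order for l >= m and in the
    other for l <= m. The estimate of the distance is the same in both cases. *)
Lemma factratio_dist m l (L : R) : (0 < m)%N -> (0 < l)%N ->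
  `|factratio m l - L| <=
  `|expR (quad_dev m l) - L| + `|expR (quad_dev m l / (l%:R / m%:R)) - L|.
Proof.
move=> m0 l0; have mR : 0 < m%:R :> R by rewrite ltr0n.
have sandwich (a b c : R) : a <= b -> b <= c -> `|b - L| <= `|a - L| + `|c - L|.
  move=> ab bc; rewrite ler_norml; apply/andP; split.
    by have := ler_norm (L - a); have := normr_ge0 (c - L); rewrite [`|L - a|]distrC; lra.
  by have := ler_norm (c - L); have := normr_ge0 (a - L); lra.
have K0 : 0 < l%:R / m%:R :> R by rewrite divr_gt0// ltr0n.
have Km : l%:R / m%:R * m%:R = l%:R :> R by rewrite divfK// gt_eqF.
have [ml|/ltnW lm] := leqP m l.
  rewrite [leRHS]addrC; apply: sandwich; last exact: factratio_le.
  apply: factratio_ge => //; last by rewrite Km.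
  by rewrite ler_pdivlMr// mul1r ler_nat.
apply: sandwich; first exact: factratio_ge_below.
by apply: factratio_le_below => //; rewrite Km.
Qed.

Lemma factratio_cvg (m l : nat -> nat) (t : R) :
    (\forall n \near \oo, 0 < m n)%N -> (\forall n \near \oo, 0 < l n)%N ->
    (fun n => (m n)%:R^-1 : R) @ \oo --> (0 : R) ->
    (fun n => (l n)%:R / (m n)%:R : R) @ \oo --> (1 : R) ->
    (fun n => ((l n)%:R - (m n)%:R) ^+ 2 / (m n)%:R : R) @ \oo --> t ->
  (fun n => factratio (m n) (l n)) @ \oo --> expR (t / 2).
Proof.
move=> m0 l0 mV lm dt.
have qcvg : (fun n => quad_dev (m n) (l n)) @ \oo --> t / 2.
  have h : (fun n => (((l n)%:R - (m n)%:R) ^+ 2 / (m n)%:R +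
       ((l n)%:R / (m n)%:R - 1)) / 2 : R) @ \oo --> (t + (1 - 1)) / 2.
    by apply: cvgM; [apply: cvgD => //; apply: cvgB => //; exact: cvg_cst|exact: cvg_cst].
  rewrite subrr addr0 in h; apply: cvg_trans h; apply: near_eq_cvg.
  near=> n; have mn : (m n)%:R != 0 :> R.
    by rewrite pnatr_eq0 -lt0n; near: n.
  by rewrite /quad_dev; field.
have e1 : (fun n => expR (quad_dev (m n) (l n))) @ \oo --> expR (t / 2).
  by apply: continuous_cvg => //; exact: continuous_expR.
have e2 : (fun n => expR (quad_dev (m n) (l n) / ((l n)%:R / (m n)%:R))) @ \oo --> expR (t / 2).
  apply: continuous_cvg; first exact: continuous_expR.
  rewrite -[X in _ --> X]divr1; apply: cvgM => //; apply: cvgV => //; exact: oner_neq0.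
apply/cvgrPdist_lt => e eps.
have e20 : 0 < e / 2 by rewrite divr_gt0.
move/cvgrPdist_lt/(_ _ e20) : e1 => e1; move/cvgrPdist_lt/(_ _ e20) : e2 => e2.
near=> n; rewrite distrC; apply: le_lt_trans (factratio_dist _ _ _) _.
- by near: n.
- by near: n.
rewrite (splitr e) ltrD// distrC; by near: n.
Unshelve. all: by end_near. Qed.

End factorial_ratio.

(** * The limit of the normalized number of tableaux *)
Section sqrt_asymptotics.
Variable R : realType.

Lemma invsqrt_cvg0 : (fun n : nat => (Num.sqrt n%:R)^-1 : R) @ \oo --> (0 : R).
Proof.
apply/cvgrPdist_lt => e e0; near=> n.
have n0 : (0 < n)%N by near: n; exists 1%N.
have sn : 0 < Num.sqrt n%:R :> R by rewrite sqrtr_gt0 ltr0n.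
rewrite sub0r normrN ger0_norm ?invr_ge0 ?ltW// invf_plt ?posrE//.
rewrite -ltr_sqr ?nnegrE ?sqrtr_ge0 ?invr_ge0 ?(ltW e0)// sqr_sqrtr//.
by near: n; exact: nbhs_infty_gtr.
Unshelve. all: by end_near. Qed.

Lemma cvg_invsqrt_bound (C a : R) (u : nat -> R) :
    (\forall n \near \oo, `|u n - a| <= C * (Num.sqrt n%:R)^-1) ->
  u @ \oo --> a.
Proof.
move=> ua; have h : (fun n : nat => C * (Num.sqrt n%:R)^-1 : R) @ \oo --> (0 : R).
  by rewrite -[X in _ --> X](mulr0 C); apply: cvgMr; exact: invsqrt_cvg0.
apply/cvgrPdist_le => e e0; move/cvgrPdist_le/(_ _ e0) : h => h.
near=> n; rewrite distrC; apply: (@le_trans _ _ (C * (Num.sqrt n%:R)^-1)).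
  by near: n.
apply: le_trans (ler_norm _) _; rewrite -normrN -sub0r; by near: n.
Unshelve. all: by end_near. Qed.

End sqrt_asymptotics.

Section normalized.
Variables (R : realType) (k : nat).
Hypothesis k0 : (0 < k)%N.

Lemma floor_div_bounds n :
  0 <= (n%:R / k%:R - (n %/ k)%:R : R) <= 1.
Proof.
have kR : 0 < k%:R :> R by rewrite ltr0n.
rewrite subr_ge0 ler_pdivlMr// -natrM ler_nat leq_trunc_div/=.
rewrite lerBlDr addrC -[1]/1%:R -natrD ler_pdivrMr// -natrM ler_nat addn1 ltnW//.
exact: ltn_ceil.
Qed.

Lemma sqrtn_facts n : (0 < n)%N ->
  [/\ 0 < Num.sqrt n%:R :> R, Num.sqrt n%:R ^+ 2 = n%:R :> R
    & 1 <= Num.sqrt n%:R :> R].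
Proof.
move=> n0; rewrite sqrtr_gt0 ltr0n n0 sqr_sqrtr//; split => //.
by rewrite -[leLHS](@sqrtr1 R) ler_sqrt// ler1n.
Qed.

Lemma div_ratio_cvg :
  (fun n => (n %/ k)%:R / n%:R : R) @ \oo --> (k%:R^-1 : R).
Proof.
apply: (@cvg_invsqrt_bound _ 1); near=> n.
have n0 : (0 < n)%N by near: n; exists 1%N.
have [sn snn sn1] := sqrtn_facts n0.
have /andP[h1 h2] := floor_div_bounds n.
have nR : 0 < n%:R :> R by rewrite ltr0n.
have -> : (n %/ k)%:R / n%:R - k%:R^-1 = - ((n%:R / k%:R - (n %/ k)%:R) / n%:R) :> R.
  by field; rewrite !gt_eqF// ltr0n.
rewrite normrN ger0_norm; last by rewrite divr_ge0.
apply: ler_pM => //.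
by rewrite lef_pV2 ?posrE// -[leRHS]snn expr2 ler_peMr// ltW.
Unshelve. all: by end_near. Qed.

Lemma invn_cvg0 : (fun n => n%:R^-1 : R) @ \oo --> (0 : R).
Proof.
apply: (@cvg_invsqrt_bound _ 1); near=> n.
have n0 : (0 < n)%N by near: n; exists 1%N.
have [sn snn sn1] := sqrtn_facts n0.
rewrite subr0 ger0_norm ?invr_ge0// mul1r lef_pV2 ?posrE ?ltr0n//.
by rewrite -[leRHS]snn expr2 ler_peMr// ltW.
Unshelve. all: by end_near. Qed.

Definition scaled_row n (s : nat -> nat) (i : nat) : R :=
  ((beta_number k s i)%:R - (n %/ k)%:R) / Num.sqrt n%:R.

(** This is f^s up to a factor that depends on n only: see [normalized_sytE]. *)
Definition normalized_syt n (s : nat -> nat) : R :=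
  diffprod (fun i : 'I_k => scaled_row n s i) *
  \prod_(i < k) (factratio R (n %/ k) (beta_number k s i))^-1.

(** Passing from s i to the beta-number adds at most k, and passing from n / k to
    its integer part changes the difference by at most 1. *)
Lemma scaled_row_close n s (x C : R) i : (0 < n)%N ->
  `|(s i)%:R - (n%:R / k%:R + x * Num.sqrt n%:R)| <= C ->
  `|scaled_row n s i - x| <= (C + k%:R + 1) * (Num.sqrt n%:R)^-1.
Proof.
move=> n0 sx; have [sn snn sn1] := sqrtn_facts n0.
have /andP[h1 h2] := floor_div_bounds n.
have -> : scaled_row n s i - x = ((beta_number k s i)%:R - (n %/ k)%:R - x * Num.sqrt n%:R)
    / Num.sqrt n%:R by rewrite /scaled_row; field; rewrite gt_eqF.
have si : 0 <= (Num.sqrt n%:R)^-1 :> R by rewrite invr_ge0 ltW.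
rewrite normrM (ger0_norm si) ler_wpM2r//.
have /andP[r0 rk] : 0 <= ((k.-1 - i)%:R : R) <= k%:R.
  by rewrite ler0n ler_nat; lia.
rewrite /beta_number natrD.
move: sx; rewrite !ler_norml => /andP[a1 a2]; apply/andP; split; lra.
Qed.

Lemma scaled_row_cvg (s : nat -> nat -> nat) (x C : R) i :
  (\forall n \near \oo, `|(s n i)%:R - (n%:R / k%:R + x * Num.sqrt n%:R)| <= C) ->
  (fun n => scaled_row n (s n) i) @ \oo --> x.
Proof.
move=> sx; apply: (@cvg_invsqrt_bound _ (C + k%:R + 1)); near=> n.
apply: scaled_row_close; first by near: n; exists 1%N.
by near: n.
Unshelve. all: by end_near. Qed.

Lemma cvg_prod_ord (I : finType) (P : pred I) (u : I -> nat -> R) (a : I -> R) :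
    (forall i, P i -> u i @ \oo --> a i) ->
  (fun n => \prod_(i | P i) u i n) @ \oo --> \prod_(i | P i) a i.
Proof. by apply: cvg_big; exact: mul_continuous. Qed.

(** The square of [scaled_row] times n / (n %/ k) is (l - m)^2 / m for l the
    beta-number and m = n %/ k. It tends to k x_i^2, which is what
    [factratio_cvg] asks for. *)
Lemma normalized_syt_cvg (s : nat -> nat -> nat) (x : 'I_k -> R) (C : R) :
    (\forall n \near \oo, forall i : 'I_k,
       `|(s n i)%:R - (n%:R / k%:R + x i * Num.sqrt n%:R)| <= C) ->
  (fun n => normalized_syt n (s n)) @ \oo -->
    diffprod x * expR (- (k%:R / 2) * \sum_(i < k) x i ^+ 2).
Proof.
move=> sx.
have tx (i : 'I_k) : (fun n => scaled_row n (s n) i) @ \oo --> x i.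
  by apply: (@scaled_row_cvg _ _ C); near=> n; move: i; near: n.
apply: cvgM.
  apply: cvg_prod_ord => i _; apply: cvg_prod_ord => j _.
  by apply: cvgB.
have -> : expR (- (k%:R / 2) * \sum_(i < k) x i ^+ 2) =
    \prod_(i < k) (expR (k%:R * x i ^+ 2 / 2))^-1 :> R.
  under [RHS]eq_bigr do rewrite -expRN.
  rewrite -expR_sum; congr expR; rewrite mulr_sumr; apply: eq_bigr => i _.
  by field.
apply: cvg_prod_ord => i _.
apply: cvgV; first by rewrite gt_eqF// expR_gt0.
have kR : k%:R != 0 :> R by rewrite pnatr_eq0 -lt0n.
have mn0 : \forall n \near \oo, (0 < n %/ k)%N.
  by exists k => // n /= kn; rewrite divn_gt0.
have nm : (fun n => n%:R / (n %/ k)%:R : R) @ \oo --> (k%:R : R).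
  rewrite -[X in _ --> X]invrK.
  have kV : k%:R^-1 != 0 :> R by rewrite invr_eq0.
  apply: cvg_trans (cvgV kV div_ratio_cvg).
  by apply: near_eq_cvg; near=> n; rewrite /= invf_div.
have bi : (fun n => (beta_number k (s n) i)%:R / (n %/ k)%:R : R) @ \oo --> (1 : R).
  have h : (fun n => 1 + scaled_row n (s n) i * (n%:R / (n %/ k)%:R) * (Num.sqrt n%:R)^-1)
     @ \oo --> 1 + x i * k%:R * 0.
    by apply: cvgD; [exact: cvg_cst|apply: cvgM; [exact: cvgM|exact: invsqrt_cvg0]].
  rewrite mulr0 addr0 in h; apply: cvg_trans h; apply: near_eq_cvg; near=> n.
  have n0 : (0 < n)%N by near: n; exists 1%N.
  have m0 : (n %/ k)%:R != 0 :> R by rewrite pnatr_eq0 -lt0n; near: n.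
  have [sn snn _] := sqrtn_facts n0.
  rewrite /scaled_row; set q := Num.sqrt n%:R in sn snn *.
  rewrite -snn; field; rewrite m0 gt_eqF//.
apply: factratio_cvg => //.
- have h : \forall n \near \oo, (0 : R) < (beta_number k (s n) i)%:R / (n %/ k)%:R.
    by apply: cvgr_gt bi _ _; exact: ltr01.
  near=> n; rewrite lt0n; apply/eqP => b0.
  have : (0 : R) < (beta_number k (s n) i)%:R / (n %/ k)%:R by near: n.
  by rewrite b0 mul0r ltxx.
- have h : (fun n => n%:R / (n %/ k)%:R * n%:R^-1 : R) @ \oo --> k%:R * (0 : R).
    by apply: cvgM => //; exact: invn_cvg0.
  rewrite mulr0 in h; apply: cvg_trans h; apply: near_eq_cvg; near=> n.
  have n0 : n%:R != 0 :> R by rewrite pnatr_eq0 -lt0n; near: n; exists 1%N.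
  by rewrite mulrAC divff// mul1r.
- have h : (fun n => scaled_row n (s n) i ^+ 2 * (n%:R / (n %/ k)%:R)) @ \oo --> x i ^+ 2 * k%:R.
    by apply: cvgM => //; rewrite expr2; under eq_fun do rewrite expr2; exact: cvgM.
  rewrite [X in _ --> X]mulrC; apply: cvg_trans h; apply: near_eq_cvg; near=> n.
  have n0 : (0 < n)%N by near: n; exists 1%N.
  have m0 : (n %/ k)%:R != 0 :> R by rewrite pnatr_eq0 -lt0n; near: n.
  have [sn snn _] := sqrtn_facts n0.
  rewrite /scaled_row expr_div_n snn; field; rewrite m0 pnatr_eq0 -lt0n n0//.
Unshelve. all: by end_near. Qed.

End normalized.

(** * An integrable bound *)
Section bounds.
Variables (R : realType) (k : nat).
Hypothesis k0 : (0 < k)%N.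

(** First d (d + 1) / 2 >= (d^2 - 1) / 4, as (d + 1)^2 >= 0, and then
    t^2 >= 2 A |t| - A^2. The slope A is free: a Gaussian decays faster than any
    exponential. *)
Lemma quad_dev_ge_linear (m n : nat) (A t d : R) : (0 < m)%N -> (m <= n)%N -> 0 <= A ->
  d ^+ 2 = t ^+ 2 * n%:R ->
  (2 * A * `|t| - A ^+ 2 - 1) / 4 <= d * (d + 1) / (2 * m%:R).
Proof.
move=> m0 mn A0 dE.
have mR : 1 <= m%:R :> R by rewrite ler1n.
have mnR : m%:R <= n%:R :> R by rewrite ler_nat.
have m0R : 0 < m%:R :> R by lra.
have t1 : 2 * A * `|t| - A ^+ 2 <= t ^+ 2.
  by rewrite -subr_ge0 -(real_normK (num_real t)) (_ : _ - _ = (`|t| - A) ^+ 2)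
    ?sqr_ge0//; ring.
have t2 : t ^+ 2 * m%:R <= d ^+ 2 by rewrite dE ler_wpM2l ?sqr_ge0.
rewrite ler_pdivlMr ?mulr_gt0//.
have d1 := sqr_ge0 (d + 1).
have : (2 * A * `|t| - A ^+ 2) * m%:R <= t ^+ 2 * m%:R by rewrite ler_wpM2r.
rewrite expr2 in d1; rewrite [d ^+ 2]expr2 in t2.
move: (2 * A * `|t| - A ^+ 2) => u; nra.
Qed.

(** The loss in the exponent when a Gaussian is replaced by an exponential of
    rate B. *)
Definition gauss_const (C B : R) : R :=
  let K := 3 * k%:R in (4 * K * B * C + 4 * (K * B) ^+ 2 + 1) / (4 * K).

Lemma factratio_exp_decay n (s : nat -> nat) (x C B : R) (i : 'I_k) : (k <= n)%N ->
  (s i <= n)%N -> 0 <= B -> `|scaled_row R k n s i - x| <= C ->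
  expR (B * `|x| - gauss_const C B) <= factratio R (n %/ k) (beta_number k s i).
Proof.
move=> kn sn B0 tx; have n0 : (0 < n)%N by exact: leq_trans kn.
have [sq sqn _] := sqrtn_facts R n0.
have m0 : (0 < n %/ k)%N by rewrite divn_gt0.
have kR : 1 <= k%:R :> R by rewrite ler1n.
have K1 : 1 <= 3 * k%:R :> R by lra.
have mn : (n %/ k <= n)%N by exact: leq_div.
(* A beta-number is at most n + k, and n < k (m + 1) for m = n %/ k, so 3 k m
   bounds it. *)
apply: (le_trans _ (@factratio_lower R _ _ (3 * k%:R) m0 K1 _)); last first.
  rewrite -!natrM ler_nat /beta_number.
  have := ltn_ceil n k0; have := ltn_ord i; nia.
rewrite ler_expR.
have dE : ((beta_number k s i)%:R - (n %/ k)%:R) ^+ 2 = scaled_row R k n s i ^+ 2 * n%:R :> R.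
  by rewrite /scaled_row expr_div_n sqn divfK// pnatr_eq0 -lt0n.
have A0 : 0 <= 2 * (3 * k%:R) * B by rewrite !mulr_ge0.
have := quad_dev_ge_linear m0 mn A0 dE; rewrite -/(quad_dev _ _ _).
set T := quad_dev _ _ _; set K := 3 * k%:R in K1 A0 *; set t := scaled_row _ _ _ _ _ in tx *.
have K0 : 0 < K by lra.
have : `|x| <= `|t| + C.
  have : `|x| <= `|t| + `|x - t| by rewrite -[leLHS](congr1 Num.norm (subrKC t x)) ler_normD.
  by rewrite distrC; lra.
move=> xt H; rewrite ler_pdivlMr// /gauss_const -/K mulrBl.
have -> : (4 * K * B * C + 4 * (K * B) ^+ 2 + 1) / (4 * K) * K =
  (4 * K * B * C + 4 * (K * B) ^+ 2 + 1) / 4 by field; rewrite gt_eqF.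
have KB : K * B * `|x| <= K * B * (`|t| + C) by rewrite ler_wpM2l// mulr_ge0// ltW.
apply: le_trans H; rewrite ler_pdivlMr//.
have -> : (B * `|x| * K - (4 * K * B * C + 4 * (K * B) ^+ 2 + 1) / 4) * 4 =
   4 * (K * B * `|x|) - (4 * K * B * C + 4 * (K * B) ^+ 2 + 1) by field.
by lra.
Qed.

(** An exponential of the sum of the |x_i| absorbs a polynomial in them. *)
Lemma diffprod_le (t x : 'I_k -> R) (C : R) : 0 <= C ->
  (forall i, `|t i - x i| <= C) ->
  `|diffprod t| <= expR ((k * k)%:R * (2 * \sum_(i < k) `|x i| + 2 * C)).
Proof.
move=> C0 tx; set N := \sum_(i < k) `|x i|; set h := 2 * N + 2 * C.
have N0 : 0 <= N by apply: sumr_ge0.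
have xN i : `|x i| <= N by rewrite /N (bigD1 i)//= lerDl sumr_ge0.
have h0 : 0 <= h by rewrite /h; lra.
have tth i j : `|t i - t j| <= expR h.
  have : `|t i - t j| <= h.
    have := tx i; have := tx j; have := xN i; have := xN j.
    rewrite !ler_norml => /andP[? ?] /andP[? ?] /andP[? ?] /andP[? ?].
    by apply/andP; split; rewrite /h; lra.
  by move=> /le_trans; apply; rewrite (le_trans _ (expR_ge1Dx _))// lerDr.
have -> : expR ((k * k)%:R * h) = \prod_(i < k) \prod_(j < k) expR h.
  by rewrite !prodr_const card_ord -exprM -expRM_natl.
rewrite normr_prod; apply: ler_prod => i _; rewrite normr_ge0/=.
rewrite normr_prod big_mkcond /=; apply: ler_prod => j _.
case: ifP => _; rewrite ?normr_ge0 ?tth// ler01/=.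
by rewrite -[leLHS]expR0 ler_expR.
Qed.

Lemma powR_expR (a b : R) : expR a `^ b = expR (b * a).
Proof. by rewrite /powR gt_eqF ?expR_gt0// expRK. Qed.

(** The rate B of the exponential decay is free, and it is taken so large
    that, after raising to the power beta, it outweighs the product of the
    differences and the q factors x_p, and still leaves the rate 1. *)
Lemma weighted_bound (beta C : R) (q : nat) : 0 < beta -> 0 <= C ->
  exists c : R, forall n (s : nat -> nat) (x : 'I_k -> R) (p : 'I_k), (k <= n)%N ->
    (forall i : 'I_k, (s i <= n)%N) ->
    (forall i : 'I_k, `|(s i)%:R - (n%:R / k%:R + x i * Num.sqrt n%:R)| <= C) ->
    0 <= normalized_syt R k n s ->
  `|(((s p)%:R - n%:R / k%:R) / Num.sqrt n%:R) ^+ q * normalized_syt R k n s `^ beta|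
    <= expR (c - \sum_(i < k) `|x i|).
Proof.
move=> b0 C0; pose C' : R := C + k%:R + 1.
pose B : R := 2 * (k * k)%:R + (q%:R + 1) / beta.
have C'0 : 0 <= C' by rewrite /C' !addr_ge0.
have B0 : 0 <= B.
  have : 0 <= (q%:R + 1) / beta by apply: divr_ge0; [exact: addr_ge0 | exact: ltW].
  by move=> h; rewrite /B addr_ge0// mulr_ge0.
exists (q%:R * C + beta * ((k * k)%:R * (2 * C') + k%:R * gauss_const C' B)).
move=> n s x p kn sn sx w0; set N := \sum_(i < k) `|x i|.
have n0 : (0 < n)%N by exact: leq_trans kn.
have [sq sqn sq1] := sqrtn_facts R n0.
have sqV : (Num.sqrt n%:R)^-1 <= 1 :> R by rewrite invf_le1.
have sqV0 : 0 <= (Num.sqrt n%:R)^-1 :> R by rewrite invr_ge0 ltW.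
have tx (i : 'I_k) : `|scaled_row R k n s i - x i| <= C'.
  apply: (le_trans (scaled_row_close k0 n0 (sx i))).
  by rewrite -[leRHS]mulr1 ler_wpM2l.
have N0 : 0 <= N by apply: sumr_ge0.
have xN i : `|x i| <= N by rewrite /N (bigD1 i)//= lerDl sumr_ge0.
have wle : normalized_syt R k n s <=
    expR ((k * k)%:R * (2 * N + 2 * C') + k%:R * gauss_const C' B - B * N).
  rewrite (le_trans (ler_norm _))// normrM -addrA expRD ler_pM//.
    exact: diffprod_le.
  have -> : k%:R * gauss_const C' B - B * N =
      \sum_(i < k) - (B * `|x i| - gauss_const C' B).
    by rewrite sumrN sumrB -mulr_sumr sumr_const card_ord -[gauss_const _ _ *+ _]mulr_natl opprB.
  rewrite expR_sum normr_prod; apply: ler_prod => i _; rewrite normr_ge0/=.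
  have mk : (0 < n %/ k)%N by rewrite divn_gt0.
  have fg : 0 < factratio R (n %/ k) (beta_number k s i) by exact: factratio_gt0.
  rewrite ger0_norm ?invr_ge0 ?(ltW fg)// expRN lef_pV2 ?posrE ?expR_gt0//.
  exact: factratio_exp_decay.
have xple : `|((s p)%:R - n%:R / k%:R) / Num.sqrt n%:R| <= expR (N + C).
  have -> : ((s p)%:R - n%:R / k%:R) / Num.sqrt n%:R =
     ((s p)%:R - (n%:R / k%:R + x p * Num.sqrt n%:R)) / Num.sqrt n%:R + x p.
    by field; rewrite !gt_eqF// ltr0n.
  have h : N + C <= expR (N + C) by rewrite (le_trans _ (expR_ge1Dx _))// lerDr.
  rewrite (le_trans (ler_normD _ _))// (le_trans _ h)// addrC lerD//.
  rewrite normrM (ger0_norm sqV0) -[leRHS]mulr1 ler_pM//.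
rewrite normrM normrX.
have -> : q%:R * C + beta * ((k * k)%:R * (2 * C') + k%:R * gauss_const C' B) - N =
   q%:R * (N + C) +
   beta * ((k * k)%:R * (2 * N + 2 * C') + k%:R * gauss_const C' B - B * N).
  rewrite /B; field; exact: lt0r_neq0.
rewrite expRD ler_pM ?exprn_ge0//.
  by rewrite expRM_natl lerXn2r ?nnegrE ?expR_ge0.
rewrite -powR_expR ger0_norm ?powR_ge0// ge0_ler_powR ?nnegrE ?expR_ge0 ?(ltW b0)//.
Qed.

End bounds.

(** * Cubes and exponentials under the product measure *)
Section lebesgue_tuple_facts.
Variable R : realType.
Local Notation RT := (measurableTypeR R).
Local Notation mu := (@lebesgue_measure R).

Definition cube m (a : 'I_m -> R) (e : R) : set (m.-tuple RT) :=
  [set y | forall j, (tnth y j : R) \in `[a j, a j + e[ ].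

Lemma measurable_cube m (a : 'I_m -> R) (e : R) : measurable (cube a e).
Proof.
have -> : cube a e = \bigcap_(j : 'I_m) ((@tnth m RT)^~ j @^-1` `[a j, a j + e[).
  by apply/seteqP; split => y /= H j; [move=> _; exact: H | exact: (H j I)].
apply: fin_bigcap_measurable; first exact: finite_finset.
move=> j _; rewrite -[X in measurable X]setTI.
by apply: measurable_tnth => //; exact: measurable_itv.
Qed.

Lemma lebesgue_tuple_cube m (a : 'I_m -> R) (e : R) : 0 <= e ->
  lebesgue_tuple R m (cube a e) = (e ^+ m)%:E.
Proof.
move=> e0; elim: m a => [|m IH] a.
  by rewrite /= diracE mem_set// => -[].
rewrite /= /lebesgue_cons /image_measure /pushforward /=.
have -> : @cons_pair R m @^-1` cube a e =
    `[a ord0, a ord0 + e[%classic `*` cube (fun j => a (lift ord0 j)) e.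
  apply/seteqP; split => -[x t] /=.
    move=> H; split; first by have := H ord0; rewrite tnth0.
    by move=> j; have := H (lift ord0 j); rewrite tnthS.
  move=> [Hx Ht] j; case: (unliftP ord0 j) => [i ->|->]; first by rewrite tnthS; exact: Ht.
  by rewrite tnth0.
rewrite product_measure1E//; last exact: measurable_cube.
rewrite [X in (X * _)%E = _]lebesgue_measure_itv/= lte_fin IH exprS EFinM.
case: ltP => [_|]; first by rewrite -EFinB addrAC subrr add0r.
rewrite gerDl => e0'; have -> : e = 0 by apply/eqP; rewrite eq_le e0 e0'.
by rewrite !mul0e.
Qed.

Definition laplace m (y : m.-tuple RT) : R := expR (- \sum_(j < m) `|tnth y j : R|).

Lemma measurable_laplace m : measurable_fun setT (@laplace m).
Proof.
apply: measurableT_comp; first exact: measurable_expR.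
apply: measurableT_comp => //.
apply: measurable_sum => j; apply: measurableT_comp => //.
exact: measurable_tnth.
Qed.

Lemma integral_laplace1 : (\int[mu]_x (expR (- `|x|))%:E < +oo)%E.
Proof.
have half : (\int[mu]_(x in [set x : R | (0 <= x)%R]) (expR (- `|x|))%:E = 1)%E.
  rewrite -(@integral_exponential_pdf R 1)// integral_mkcond.
  apply: eq_integral => x _; rewrite /exponential_pdf !patchE.
  have -> : (x \in [set x | 0 <= x]) = (x \in `[0, +oo[%classic).
    by apply/idP/idP; rewrite !inE/= in_itv/= andbT.
  case: ifPn => //; rewrite inE/= in_itv/= andbT => x0.
  by rewrite ger0_norm// mulN1r mul1r.
rewrite (@ge0_symfun_integralT R (fun x => expR (- `|x|))).
- by rewrite half mule1 ltry.
- by move=> x; exact: expR_ge0.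
- move=> x; apply: continuous_comp; last exact: continuous_expR.
  by apply: continuousN; exact: norm_continuous.
- by move=> x; rewrite /= normrN.
Qed.

(** By Tonelli's theorem the integral is a power of the one-dimensional one. *)
Lemma integral_laplace m : (\int[lebesgue_tuple R m]_y (laplace y)%:E < +oo)%E.
Proof.
elim: m => [|m IH].
  rewrite /= integral_dirac//=.
    by rewrite diracT mul1e ltry.
  by apply/measurable_EFinP; exact: measurable_laplace.
have mL : measurable_fun setT (EFin \o @laplace m.+1).
  by apply/measurable_EFinP; exact: measurable_laplace.
have L0 : {in setT, forall y, (0 <= (EFin \o @laplace m.+1) y)%E}.
  by move=> y _; rewrite lee_fin expR_ge0.
have E := @ge0_integral_pushforward _ _ _ _ R _ (@measurable_cons_pair R m)
  (lebesgue_measure \x lebesgue_tuple R m)%E setT _ measurableT mL L0.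
have -> : (\int[lebesgue_tuple R m.+1]_y (laplace y)%:E)%E = _ := E.
rewrite preimage_setT.
rewrite (eq_integral (fun z : RT * m.-tuple RT => (expR (- `|z.1|))%:E * (laplace z.2)%:E)%E).
  rewrite fubini_tonelli1/=; first last.
  - by move=> z; rewrite mule_ge0// lee_fin expR_ge0.
  - apply: emeasurable_funM; apply/measurable_EFinP.
      by do 3! (apply: measurableT_comp => //).
    by apply: measurableT_comp => //; exact: measurable_laplace.
  rewrite /fubini_F /=.
  have mLm : measurable_fun setT (EFin \o @laplace m).
    by apply/measurable_EFinP; exact: measurable_laplace.
  rewrite (eq_integral (fun x : RT => (expR (- `|x : R|))%:E *
      \int[lebesgue_tuple R m]_y (laplace y)%:E)%E); last first.
    move=> x _; rewrite (ge0_integralZl _ measurableT mLm)//.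
    by move=> y _; rewrite lee_fin expR_ge0.
  have mE : measurable_fun setT (fun x : RT => (expR (- `|x : R|))%:E).
    by apply/measurable_EFinP; do 2! (apply: measurableT_comp => //).
  rewrite ge0_integralZr//.
  - apply: lte_mul_pinfty => //; first exact: integral_ge0.
    by rewrite ge0_fin_numE ?integral_laplace1// integral_ge0.
  - by apply: integral_ge0 => y _; rewrite lee_fin expR_ge0.
move=> [x t] _ /=; rewrite -EFinM /laplace -expRD big_ord_recl /= tnth0 opprD.
by under eq_bigr do rewrite tnthS.
Qed.

End lebesgue_tuple_facts.

(** * Rounding points of the hyperplane to partitions *)
Section hyperplane.
Variables (R : realType) (h : nat).
Local Notation k := h.+1.
Local Notation RT := (measurableTypeR R).
Implicit Types (y : h.-tuple RT).

Definition plane_coord y (i : 'I_k) : R := tnth (@hyperplane_pt R k y) i.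

Lemma plane_coord_widen y (j : 'I_h) : plane_coord y (widen_ord (leqnSn h) j) = tnth y j.
Proof.
rewrite /plane_coord /hyperplane_pt tnth_mktuple /=.
case: insubP => [u _ /val_inj ->//|]; by rewrite ltn_ord.
Qed.

Lemma plane_coord_max y : plane_coord y ord_max = - \sum_(j < h) (tnth y j : R).
Proof. by rewrite /plane_coord /hyperplane_pt tnth_mktuple /= insubN// ltnn. Qed.

Lemma sum_plane_coord y : \sum_(i < k) plane_coord y i = 0.
Proof.
rewrite big_ord_recr /= plane_coord_max; apply/eqP; rewrite subr_eq0; apply/eqP.
by apply: eq_bigr => j _; rewrite plane_coord_widen.
Qed.

Lemma sum_norm_plane_coord y : \sum_(j < h) `|tnth y j : R| <= \sum_(i < k) `|plane_coord y i|.
Proof.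
rewrite [leRHS]big_ord_recr /= (eq_bigr (fun j => `|plane_coord y (widen_ord (leqnSn h) j)|)).
  by rewrite lerDl.
by move=> j _; rewrite plane_coord_widen.
Qed.

Section rounding.
Variable n : nat.

Definition ideal_part y (i : 'I_k) : R := n%:R / k%:R + plane_coord y i * Num.sqrt n%:R.

Lemma sum_ideal_part y : \sum_(i < k) ideal_part y i = n%:R.
Proof.
rewrite big_split /= -[X in _ + X]mulr_suml sum_plane_coord mul0r addr0 sumr_const card_ord.
by rewrite -[_ *+ k]mulr_natr divfK// pnatr_eq0.
Qed.

(** Rounding all the parts would spoil the sum n, so the last part is what the
    other ones leave. *)
Definition rounded_part y (i : nat) : nat :=
  let t (j : 'I_h) := Num.truncn (ideal_part y (widen_ord (leqnSn h) j)) in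
  if insub i is Some j then t j
  else if i == h then (n - \sum_(j < h) t j)%N else 0%N.

Lemma rounded_part_widen y (j : 'I_h) :
  rounded_part y j = Num.truncn (ideal_part y (widen_ord (leqnSn h) j)).
Proof.
by rewrite /rounded_part; case: insubP => [u _ /val_inj ->//|]; rewrite ltn_ord.
Qed.

Lemma rounded_part_max y : rounded_part y h = (n - \sum_(j < h) rounded_part y j)%N.
Proof.
rewrite {1}/rounded_part insubN ?ltnn// eqxx; congr (_ - _)%N.
by apply: eq_bigr => j _; rewrite rounded_part_widen.
Qed.

Lemma rounded_part_default y i : (k <= i)%N -> rounded_part y i = 0%N.
Proof. by move=> ki; rewrite /rounded_part insubN ?gtn_eqF//; lia. Qed.

(** Under these conditions neither the rounding nor the subtraction in
    [rounded_part] is truncated at 0. *)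
Definition admissible y :=
  (forall j : 'I_h, 0 <= ideal_part y (widen_ord (leqnSn h) j)) /\
  (\sum_(j < h) rounded_part y j <= n)%N.

Lemma sum_rounded_part y : admissible y -> (\sum_(i < k) rounded_part y i = n)%N.
Proof. by move=> [_ yn]; rewrite big_ord_recr /= rounded_part_max subnKC. Qed.

Lemma rounded_part_close y : admissible y ->
  forall i : 'I_k, `|(rounded_part y i)%:R - ideal_part y i| <= k%:R.
Proof.
move=> yA; have [y0 yn] := yA.
have tr (j : 'I_h) : 0 <= ideal_part y (widen_ord (leqnSn h) j) - (rounded_part y j)%:R <= (1 : R).
  have /andP[a b] := truncn_itv (y0 j).
  rewrite rounded_part_widen subr_ge0 a /= lerBlDr addrC natr1; exact: ltW.
move=> i; case: (unliftP ord_max i) => [j ->|->].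
  have -> : lift ord_max j = widen_ord (leqnSn h) j by apply/val_inj; exact: lift_max.
  have /andP[a b] := tr j; rewrite distrC ger0_norm// (le_trans b)// ler1n//.
rewrite rounded_part_max natrB// natr_sum.
have -> : n%:R - \sum_(j < h) (rounded_part y j)%:R - ideal_part y ord_max =
   \sum_(j < h) (ideal_part y (widen_ord (leqnSn h) j) - (rounded_part y j)%:R).
  by rewrite -[in LHS](sum_ideal_part y) big_ord_recr /= sumrB; ring.
rewrite (le_trans (ler_norm_sum _ _ _))// (@le_trans _ _ (\sum_(j < h) 1))//.
  by apply: ler_sum => j _; have /andP[a b] := tr j; rewrite ger0_norm.
by rewrite sumr_const card_ord ler_nat.
Qed.

End rounding.

Section box.
Variable n : nat.
Hypothesis n0 : (0 < n)%N.
Implicit Type l : n.-tuple 'I_n.+1.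

Definition corner l (j : 'I_h) : R := ((part l j)%:R - n%:R / k%:R) / Num.sqrt n%:R.

(** The first k - 1 parts determine a partition of n with at most k parts, so
    these cubes are disjoint for distinct partitions. *)
Definition box l : set (h.-tuple RT) :=
  cube (corner l) (Num.sqrt n%:R)^-1.

Lemma boxP l y : box l y <-> forall j : 'I_h,
  (part l j)%:R <= ideal_part n y (widen_ord (leqnSn h) j) < (part l j).+1%:R.
Proof.
have [sn _ _] := sqrtn_facts R n0.
have cE (j : 'I_h) : corner l j + (Num.sqrt n%:R)^-1 =
    ((part l j)%:R - n%:R / k%:R + 1) / Num.sqrt n%:R.
  by rewrite /corner [in RHS]mulrDl mul1r.
rewrite /box /cube/=; split => H j; have := H j;
  rewrite in_itv/= cE /corner /ideal_part plane_coord_widen ler_pdivrMr// ltr_pdivlMr// -natr1;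
  by move=> /andP[? ?]; apply/andP; split; lra.
Qed.

Lemma box_rounded_part l y : l \in H_k0 k n -> box l y -> part l =1 rounded_part n y.
Proof.
move=> lH /boxP yl.
have small (j : 'I_h) : part l j = rounded_part n y j.
  by rewrite rounded_part_widen; apply/esym/truncn_def/yl.
move=> i; have [|ih|->] := ltngtP i h.
- by move=> ih; have := small (Ordinal ih).
- by rewrite rounded_part_default// (H_k0_part lH).
- rewrite rounded_part_max -(eq_bigr _ (fun j _ => small j)).
  by have := H_k0_sum lH; rewrite big_ord_recr /=; lia.
Qed.

Lemma box_admissible l y : l \in H_k0 k n -> box l y -> admissible n y.
Proof.
move=> lH yl; split.
  by move=> j; have /boxP/(_ j)/andP[+ _] := yl; apply: le_trans.
rewrite -[leqRHS](H_k0_sum lH) big_ord_recr /=.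
rewrite (eq_bigr (fun j : 'I_h => part l j)) ?leq_addr// => j _.
by rewrite (box_rounded_part lH yl).
Qed.

Lemma box_inj l l' y : l \in H_k0 k n -> l' \in H_k0 k n -> box l y -> box l' y ->
  l = l'.
Proof.
move=> lH lH' yl yl'; apply/eq_from_tnth => i; apply/val_inj => /=.
have partE (a : n.-tuple 'I_n.+1) : part a i = tnth a i.
  by rewrite /part (nth_map ord0) ?size_tuple// -tnth_nth.
by rewrite -!partE (box_rounded_part lH yl) (box_rounded_part lH' yl').
Qed.

Lemma rounded_part_box y : (k <= n)%N -> admissible n y ->
    (forall i, (i < h)%N -> (rounded_part n y i.+1 <= rounded_part n y i)%N) ->
  exists2 l, l \in H_k0 k n & box l y.
Proof.
move=> kn yA ymono; have ys := sum_rounded_part yA.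
have rle i : (rounded_part n y i <= n)%N.
  have [ik|ki] := ltnP i k; last by rewrite rounded_part_default.
  by rewrite -[leqRHS]ys (bigD1 (Ordinal ik))//= leq_addr.
pose l : n.-tuple 'I_n.+1 := [tuple inord (rounded_part n y i) | i < n].
have lE i : part l i = rounded_part n y i.
  have [il|li] := ltnP i n; last first.
    by rewrite part_default// rounded_part_default// (leq_trans kn).
  rewrite /part (nth_map ord0) ?size_tuple// -[nth _ _ _](tnth_nth _ l (Ordinal il)).
  by rewrite tnth_mktuple /= inordK// ltnS.
exists l; last first.
  apply/boxP => j; rewrite lE rounded_part_widen; apply: truncn_itv; exact: yA.1.
rewrite inE /is_partition lE rounded_part_default// eqxx andbT; apply/andP; split.
  apply/(sortedP 0%N) => i _; rewrite -/(part l i) -/(part l i.+1) !lE.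
  have [ih|hi] := ltnP i h; first exact: ymono.
  by have -> : rounded_part n y i.+1 = 0%N by exact: rounded_part_default.
rewrite (@eq_sum_supp _ _ k).
- by rewrite -[X in _ == X]ys; apply/eqP/eq_bigr => i _; rewrite lE.
- exact: part_default.
- by move=> i ki; rewrite lE rounded_part_default.
Qed.

End box.

Lemma near_admissible y : \forall n \near \oo, admissible n y.
Proof.
pose M := \sum_(i < k) `|plane_coord y i|.
near=> n; have n0 : (0 < n)%N by near: n; exists 1%N.
have [sn snn _] := sqrtn_facts R n0.
have r0 i : 0 <= ideal_part n y i.
  rewrite /ideal_part; set q := Num.sqrt n%:R in sn snn *; rewrite -snn.
  have -> : q ^+ 2 / k%:R + plane_coord y i * q = q / k%:R * (q + plane_coord y i * k%:R).
    by field; rewrite addrC natr1 pnatr_eq0.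
  rewrite mulr_ge0 ?divr_ge0 ?(ltW sn)//.
  have xM : `|plane_coord y i| <= M by rewrite /M (bigD1 i)//= lerDl sumr_ge0.
  have Mq : M * k%:R <= q.
    rewrite -ler_sqr ?nnegrE ?mulr_ge0 ?sumr_ge0 ?(ltW sn)// snn.
    by near: n; exact: nbhs_infty_ger.
  have : - plane_coord y i * k%:R <= M * k%:R.
    by rewrite ler_wpM2r// (le_trans _ xM)// -normrN ler_norm.
  by rewrite mulNr; lra.
split=> [j//|]; rewrite -(ler_nat R) natr_sum.
have := sum_ideal_part n y; rewrite big_ord_recr /=.
have : \sum_(j < h) (rounded_part n y j)%:R <= \sum_(j < h) ideal_part n y (widen_ord (leqnSn h) j).
  by apply: ler_sum => j _; rewrite rounded_part_widen truncn_le.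
by have := r0 ord_max; lra.
Unshelve. all: by end_near. Qed.

End hyperplane.

(** * Step functions and their pointwise limit *)
Lemma cvg_powR (R : realType) (u : nat -> R) (a b : R) : 0 < b ->
    (forall n, 0 <= u n) -> u @ \oo --> a ->
  (fun n => u n `^ b) @ \oo --> a `^ b.
Proof.
move=> b0 u0 ua.
have a0 : 0 <= a by apply: (cvgr_to_ge ua); near=> n; exact: u0.
move: a0; rewrite le_eqVlt => /orP[/eqP a0|a0]; last first.
  have h : (fun n => expR (b * ln (u n))) @ \oo --> expR (b * ln a).
    apply: continuous_cvg; first exact: continuous_expR.
    apply: cvgMr; apply: continuous_cvg => //; exact: continuous_ln.
  rewrite {2}/powR (gt_eqF a0); apply: cvg_trans h; apply: near_eq_cvg.
  near=> n; have un : 0 < u n by near: n; exact: (cvgr_gt _ ua _ a0).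
  by rewrite /powR gt_eqF.
rewrite -a0 powR0 ?gt_eqF//; rewrite -a0 in ua.
apply/cvgrPdist_lt => e e0; have d0 : 0 < e `^ b^-1 by rewrite powR_gt0.
move/cvgrPdist_lt/(_ _ d0) : ua => ua; near=> n.
rewrite sub0r normrN ger0_norm ?powR_ge0//.
have : `|0 - u n| < e `^ b^-1 by near: n.
rewrite sub0r normrN ger0_norm// => ue.
rewrite -[ltRHS]powRr1 ?(ltW e0)// -(mulVf (lt0r_neq0 b0)) powRrM.
by rewrite gt0_ltr_powR ?nnegrE ?powR_ge0.
Unshelve. all: by end_near. Qed.

Section masses.
Variables (R : realType) (k : nat).
Hypothesis k0 : (0 < k)%N.

(** The exponents of m in the ratios of factorials add up to the sum of the
    beta-numbers, which is the same for all the partitions of n with at most k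
    parts. *)
Lemma normalized_sytE n : (k <= n)%N -> exists2 a : R, 0 < a &
  forall l, l \in H_k0 k n -> normalized_syt R k n (part l) = a * (num_syt l)%:R.
Proof.
move=> kn; have n0 : (0 < n)%N by exact: leq_trans kn.
have [sn _ _] := sqrtn_facts R n0.
set m := (n %/ k)%N; have m0 : (0 < m)%N by rewrite divn_gt0.
have mR : 0 < m%:R :> R by rewrite ltr0n.
have fR j : 0 < j`!%:R :> R by rewrite ltr0n fact_gt0.
pose c : R := \prod_(i < k) \prod_(j < k | (i < j)%N) (Num.sqrt n%:R)^-1.
pose e : R := \prod_(i < k) (m`!%:R * m%:R ^+ (k.-1 - i) / m%:R ^+ m).
exists (c * (e * m%:R ^+ n) / n`!%:R).
  rewrite divr_gt0// mulr_gt0 ?mulr_gt0 ?exprn_gt0// prodr_gt0// => i _.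
    by rewrite prodr_gt0// => j _; rewrite invr_gt0.
  by rewrite divr_gt0 ?mulr_gt0 ?exprn_gt0.
move=> l lH; have := num_syt_frobenius lH R.
set P := \prod_(i < k) _ => H.
have P0 : 0 < P by apply: prodr_gt0.
have -> : (num_syt l)%:R = n`!%:R * diffprod (fun i : 'I_k => (beta_number k (part l) i)%:R) / P.
  by rewrite -H mulfK// gt_eqF.
rewrite /normalized_syt -/m.
have -> : diffprod (fun i : 'I_k => scaled_row R k n (part l) i) =
    diffprod (fun i : 'I_k => (beta_number k (part l) i)%:R) * c.
  rewrite /diffprod -big_split /=; apply: eq_bigr => i _.
  rewrite -big_split /=; apply: eq_bigr => j _.
  by rewrite /scaled_row -mulrBl; congr (_ / _); ring.
have -> : \prod_(i < k) (factratio R m (beta_number k (part l) i))^-1 =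
    e * m%:R ^+ n / P.
  have -> : m%:R ^+ n = \prod_(i < k) m%:R ^+ (part l i) :> R.
    by rewrite prodrXr (H_k0_sum lH).
  rewrite /e /P -prodfV -!big_split /=; apply: eq_bigr => i _.
  rewrite /factratio /beta_number exprD; field.
  by rewrite !expf_neq0 ?gt_eqF.
by field; rewrite !gt_eqF.
Qed.

Variables (beta : R) (p q n : nat).

(** The sums of these terms for q = 1 and q = 0 are, up to a common factor, the
    numerator and the denominator of c_p(n). *)
Definition moment_term (l : n.-tuple 'I_n.+1) : R :=
  (((part l p)%:R - n%:R / k%:R) / Num.sqrt n%:R) ^+ q *
  normalized_syt R k n (part l) `^ beta.

End masses.

(** Subtracting n / k and dividing by sqrt n commutes with taking the mean, and
    the factor of [normalized_sytE] cancels. *)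
Lemma cE_ratio (R : realType) (k n : nat) (beta : R) (p : 'I_k) :
    (0 < k)%N -> (k <= n)%N ->
    \sum_(l in H_k0 k n) moment_term k beta p 0 l != 0 ->
  cE beta k p n = (\sum_(l in H_k0 k n) moment_term k beta p 1 l) /
                  (\sum_(l in H_k0 k n) moment_term k beta p 0 l).
Proof.
move=> k0 kn; have [a a0 wE] := normalized_sytE R k0 kn.
have n0 : (0 < n)%N by exact: leq_trans kn.
have [sn _ _] := sqrtn_facts R n0.
have kR : 0 < k%:R :> R by rewrite ltr0n.
have wb l : l \in H_k0 k n ->
    normalized_syt R k n (part l) `^ beta = a `^ beta * (num_syt l)%:R `^ beta.
  by move=> lH; rewrite wE// powRM// ltW.
pose D : R := \sum_(l in H_k0 k n) (num_syt l)%:R `^ beta.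
pose N : R := \sum_(l in H_k0 k n) (part l p)%:R * (num_syt l)%:R `^ beta.
have -> : \sum_(l in H_k0 k n) moment_term k beta p 0 l = a `^ beta * D.
  by rewrite mulr_sumr; apply: eq_bigr => l lH; rewrite /moment_term expr0 mul1r wb.
have -> : \sum_(l in H_k0 k n) moment_term k beta p 1 l =
    a `^ beta * ((N - n%:R / k%:R * D) / Num.sqrt n%:R).
  rewrite /N [_ * D]mulr_sumr -sumrB mulr_suml mulr_sumr; apply: eq_bigr => l lH.
  by rewrite /moment_term expr1 wb//; ring.
rewrite mulf_eq0 negb_or => /andP[ab D0].
rewrite /cE /lambdaE -/D -/N; field.
by rewrite ab D0 !gt_eqF.
Qed.

Section pointwise.
Variables (R : realType) (h : nat).
Local Notation k := h.+1.
Local Notation RT := (measurableTypeR R).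
Variables (beta : R) (q : nat) (p : 'I_k).
Hypothesis beta0 : 0 < beta.
Implicit Types (y : h.-tuple RT).

Definition step_density n y : R :=
  \sum_(l in H_k0 k n) moment_term k beta p q l * \1_(@box R h n l) y.

Definition moment_density (x : k.-tuple RT) : R := tnth x p ^+ q * weight beta x.

Lemma step_densityP n y : (0 < n)%N ->
  (exists2 l, l \in H_k0 k n /\ @box R h n l y & step_density n y = moment_term k beta p q l) \/
  (step_density n y = 0 /\ forall l, l \in H_k0 k n -> ~ @box R h n l y).
Proof.
move=> n0; have [[l [lH yl]]|nol] := pselect (exists l, l \in H_k0 k n /\ @box R h n l y).
  left; exists l => //; rewrite /step_density (bigD1 l)//= indicE mem_set// mulr1.
  rewrite big1 ?addr0// => l' /andP[lH' ll']; rewrite indicE memNset ?mulr0// => yl'.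
  by case/eqP: ll'; exact: (box_inj n0 lH' lH yl' yl).
right; split; last by move=> l lH yl; apply: nol; exists l.
rewrite /step_density big1// => l lH; rewrite indicE memNset ?mulr0// => yl.
by apply: nol; exists l.
Qed.

Lemma step_density_bound : exists c : R, forall n y, (k <= n)%N ->
  `|step_density n y| <= expR c * laplace y.
Proof.
have [c cP] := @weighted_bound R k isT beta k%:R q beta0 (ler0n _ _).
exists c => n y kn; have n0 : (0 < n)%N by exact: leq_trans kn.
have [[l [lH yl] ->]|[-> _]] := step_densityP y n0; last first.
  by rewrite normr0 mulr_ge0// expR_ge0.
have yA := box_admissible n0 lH yl; have pE := box_rounded_part n0 lH yl.
have [a a0 wE] := normalized_sytE R (ltn0Sn h) kn.
apply: (le_trans (cP n (part l) (plane_coord y) p kn _ _ _)).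
- by move=> i; exact: part_le.
- by move=> i; rewrite pE; exact: rounded_part_close.
- by rewrite wE// mulr_ge0// ltW.
- by rewrite /laplace -expRD ler_expR lerB// sum_norm_plane_coord.
Qed.

Lemma rounded_part_lt y (i j : 'I_k) : plane_coord y i < plane_coord y j ->
  \forall n \near \oo, (rounded_part n y i < rounded_part n y j)%N.
Proof.
move=> xij; set d := plane_coord y j - plane_coord y i; have d0 : 0 < d by rewrite subr_gt0.
have e0 : 0 < d / (2 * k%:R + 1) by rewrite divr_gt0// ltr_wpDl// mulr_ge0.
have := @invsqrt_cvg0 R; move/cvgrPdist_lt/(_ _ e0) => hs.
near=> n; have n0 : (0 < n)%N by near: n; exists 1%N.
have [sn _ _] := sqrtn_facts R n0.
have yA : admissible n y by near: n; exact: near_admissible.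
have ri := rounded_part_close yA i; have rj := rounded_part_close yA j.
have : `|0 - (Num.sqrt n%:R)^-1| < d / (2 * k%:R + 1) by near: n.
rewrite sub0r normrN ger0_norm ?invr_ge0 ?(ltW sn)// -[ltLHS]mul1r ltr_pdivrMr//.
rewrite mulrAC ltr_pdivlMr ?mul1r; last by rewrite ltr_wpDl// mulr_ge0.
rewrite -(ltr_nat R); move: ri rj; rewrite !ler_norml /ideal_part /d mulrBl.
move: (n%:R / k%:R : R) (k%:R : R) => c K /andP[? ?] /andP[? ?]; lra.
Unshelve. all: by end_near. Qed.

(** On Omega, the step function at y is the normalized weight F n at the rounded
    point, or 0 when the rounded point is not a partition. F n tends to the
    claimed value. If that value is 0 because x lies on a wall, both cases agree
    in the limit. Otherwise the coordinates of x are strictly decreasing, and the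
    rounded point is a partition for large n. Outside Omega two coordinates are
    in the wrong order, and so are the corresponding rounded parts. *)
Lemma step_density_cvg y :
  (fun n => step_density n y) @ \oo -->
    (if @hyperplane_pt R k y \in Omega then moment_density (@hyperplane_pt R k y)
     else 0 : R).
Proof.
set x := @hyperplane_pt R k y.
pose F n : R := (((rounded_part n y p)%:R - n%:R / k%:R) / Num.sqrt n%:R) ^+ q *
  `|normalized_syt R k n (rounded_part n y)| `^ beta.
have rc : \forall n \near \oo, forall i : 'I_k,
    `|(rounded_part n y i)%:R - (n%:R / k%:R + plane_coord y i * Num.sqrt n%:R)| <= k%:R.
  by near=> n; apply: rounded_part_close; near: n; exact: near_admissible.
have massF n l : (k <= n)%N -> l \in H_k0 k n -> box l y -> moment_term k beta p q l = F n.
  move=> kn lH yl; have n0 : (0 < n)%N by exact: leq_trans kn.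
  have [a a0 wE] := normalized_sytE R (ltn0Sn h) kn.
  have pE : part l = rounded_part n y by apply/funext; exact: box_rounded_part.
  have w0 : 0 <= normalized_syt R k n (part l) by rewrite wE// mulr_ge0// ltW.
  by rewrite /F /moment_term -pE (ger0_norm w0).
have FL : F @ \oo --> tnth x p ^+ q *
    (`|Dk x * expR (- (k%:R / 2) * \sum_(i < k) (tnth x i : R) ^+ 2)|) `^ beta.
  apply: cvgM.
    have xp : (fun n => ((rounded_part n y p)%:R - n%:R / k%:R) / Num.sqrt n%:R : R) @ \oo -->
        (tnth x p : R).
      apply: (@cvg_invsqrt_bound _ k%:R); near=> n.
      have n0 : (0 < n)%N by near: n; exists 1%N.
      have [sn _ _] := sqrtn_facts R n0.
      have -> : ((rounded_part n y p)%:R - n%:R / k%:R) / Num.sqrt n%:R - tnth x p =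
         ((rounded_part n y p)%:R - (n%:R / k%:R + plane_coord y p * Num.sqrt n%:R))
         / Num.sqrt n%:R :> R.
        by rewrite /plane_coord -/x; field; rewrite gt_eqF//= addrC natr1 pnatr_eq0.
      have si : 0 <= (Num.sqrt n%:R)^-1 :> R by rewrite invr_ge0 ltW.
      rewrite normrM (ger0_norm si) ler_wpM2r//; move: (p); near: n; exact: rc.
    exact: (cvg_comp _ _ xp (@exprn_continuous R q (tnth x p))).
  apply: cvg_powR => //; apply: cvg_norm.
  exact: (normalized_syt_cvg (ltn0Sn h) rc).
case: ifPn => [/set_mem xO|/negP xO].
  have D0 : 0 <= Dk x.
    apply: prodr_ge0 => i _; apply: prodr_ge0 => j ij.
    by rewrite subr_ge0; apply: xO.1; exact: ltnW.
  rewrite ger0_norm in FL; last by rewrite mulr_ge0// expR_ge0.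
  rewrite -/(weight beta x) -/(moment_density x) in FL.
  move: D0; rewrite le_eqVlt => /orP[/eqP D0|D0].
    have L0 : moment_density x = 0.
      by rewrite /moment_density /weight -D0 mul0r powR0 ?mulr0// gt_eqF.
    rewrite L0 in FL *; apply/cvgrPdist_lt => e e0.
    move/cvgrPdist_lt/(_ _ e0) : FL => FL; near=> n.
    have kn : (k <= n)%N by near: n; exists k.
    have n0 : (0 < n)%N by exact: leq_trans kn.
    have [[l [lH yl] ->]|[-> _]] := step_densityP y n0; last by rewrite subrr normr0.
    by rewrite (massF _ _ kn lH yl); near: n.
  apply: cvg_trans FL; apply: near_eq_cvg; near=> n.
  have kn : (k <= n)%N by near: n; exists k.
  have n0 : (0 < n)%N by exact: leq_trans kn.
  have yA : admissible n y by near: n; exact: near_admissible.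
  have mono : forall i, (i < h)%N -> (rounded_part n y i.+1 <= rounded_part n y i)%N.
    suff : forall i : 'I_h, (rounded_part n y i.+1 < rounded_part n y i)%N.
      by move=> H i ih; apply/ltnW/(H (Ordinal ih)).
    near: n; apply: filter_forall => i.
    have := @rounded_part_lt y (lift ord0 i) (widen_ord (leqnSn h) i); apply.
    rewrite lt_neqAle; apply/andP; split; last first.
      by apply: xO.1; rewrite /= /bump /= add1n.
    apply/negP => /eqP e; move: D0; rewrite lt0r => /andP[/negP + _]; apply.
    rewrite /Dk (bigD1 (widen_ord (leqnSn h) i))//= (bigD1 (lift ord0 i))//=.
    have {}e : tnth x (lift ord0 i) = tnth x (widen_ord (leqnSn h) i) by exact: e.
    by rewrite e subrr !mul0r.
  have [l lH yl] := rounded_part_box n0 kn yA mono.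
  have [[l' [lH' yl'] ->]|[_ /(_ _ lH)//]] := step_densityP y n0.
  by rewrite (massF _ _ kn lH' yl').
have [i [j [ij xij]]] : exists i j : 'I_k, (i <= j)%N /\ plane_coord y i < plane_coord y j.
  apply: contrapT => H; apply: xO; apply/mem_set; split; last exact: sum_plane_coord.
  move=> i j ij; rewrite leNgt; apply/negP => xij; apply: H; exists i, j; split => //.
have c0 : (fun _ : nat => 0 : R) @ \oo --> (0 : R) by exact: cvg_cst.
apply: cvg_trans c0; apply: near_eq_cvg; near=> n.
have n0 : (0 < n)%N by near: n; exists 1%N.
have rij : (rounded_part n y i < rounded_part n y j)%N by near: n; exact: rounded_part_lt.
have [[l [lH yl] _]|[-> //]] := step_densityP y n0.
have := leq_nonincreasing (part_nonincreasing (H_k0_partition lH)) ij.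
by rewrite !(box_rounded_part n0 lH yl); lia.
Unshelve. all: by end_near. Qed.

End pointwise.

(** * Convergence of the Riemann sums *)
Section measurability.
Variables (R : realType) (k : nat).
Local Notation RT := (measurableTypeR R).

Lemma measurable_coord (i : 'I_k) :
  measurable_fun setT (fun x : k.-tuple RT => tnth x i : R).
Proof. exact: measurable_tnth. Qed.

Lemma measurable_Omega : measurable (@Omega R k).
Proof.
have -> : @Omega R k =
    (\bigcap_(i : 'I_k) \bigcap_(j : 'I_k)
       (if (i <= j)%N then [set x | tnth x j <= tnth x i :> R] else setT)) `&`
    ((fun x : k.-tuple RT => \sum_(i < k) (tnth x i : R)) @^-1` [set 0]).
  apply/seteqP; split => x /= [H1 H2]; split => //.
    by move=> i _ j _; case: ifP => // ij; exact: H1.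
  by move=> i j ij; have := H1 i I j I; rewrite ij.
apply: measurableI; last first.
  rewrite -[X in measurable X]setTI.
  have m0 : measurable_fun setT (fun x : k.-tuple RT => \sum_(i < k) (tnth x i : R)).
    by apply: measurable_sum => i; exact: measurable_coord.
  by apply: m0 => //; exact: measurable_set1.
apply: fin_bigcap_measurable => [|i _]; first exact: finite_finset.
apply: fin_bigcap_measurable => [|j _]; first exact: finite_finset.
case: ifP => // _; rewrite -[X in measurable X]setTI.
by apply: measurable_fun_le => //; exact: measurable_coord.
Qed.

Lemma measurable_Dk : measurable_fun setT (@Dk R k).
Proof.
apply: measurable_prod => i _.
under eq_fun do rewrite big_mkcond/=.
apply: measurable_prod => j _; case: (i < j)%N; last exact: measurable_cst.
by apply: measurable_funB; exact: measurable_coord.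
Qed.

Lemma measurable_weight (beta : R) : measurable_fun setT (@weight R k beta).
Proof.
apply: (measurableT_comp (measurable_powR _)).
apply: measurable_funM; first exact: measurable_Dk.
apply: measurableT_comp; first exact: measurable_expR.
apply: measurable_funM; first exact: measurable_cst.
by apply: measurable_sum => i; apply: measurable_funX; exact: measurable_coord.
Qed.

End measurability.

Section convergence.
Variables (R : realType) (h : nat).
Local Notation k := h.+1.
Local Notation RT := (measurableTypeR R).
Local Notation mu := (lebesgue_tuple R h).
Variables (beta : R) (p : 'I_k).
Hypothesis beta0 : 0 < beta.

Section fixed_exponent.
Variable q : nat.

Local Notation moment_density := (@moment_density R h beta q p).
Local Notation step_density := (@step_density R h beta q p).

Lemma measurable_moment_density : measurable_fun setT moment_density.
Proof.
apply: measurable_funM; last exact: measurable_weight.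
by apply: measurable_funX; exact: measurable_coord.
Qed.

Lemma measurable_box n (l : n.-tuple 'I_n.+1) : measurable (@box R h n l).
Proof. exact: measurable_cube. Qed.

Lemma measure_box n (l : n.-tuple 'I_n.+1) :
  mu (box l) = ((Num.sqrt n%:R)^-1 ^+ h)%:E.
Proof. by apply: lebesgue_tuple_cube; rewrite invr_ge0. Qed.

Lemma measurable_step_density n : measurable_fun setT (step_density n).
Proof.
rewrite /step_density; under eq_fun do rewrite big_mkcond/=.
apply: measurable_sum => l; case: (l \in H_k0 k n); last exact: measurable_cst.
apply: measurable_funM; first exact: measurable_cst.
by apply: measurable_indic; exact: measurable_box.
Qed.

Lemma integral_step_density n : (\int[mu]_y (step_density n y)%:E =
  ((Num.sqrt n%:R)^-1 ^+ h * \sum_(l in H_k0 k n) moment_term k beta p q l)%:E)%E.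
Proof.
have mI (l : n.-tuple 'I_n.+1) :
    mu.-integrable setT (fun y => (\1_(@box R h n l) y)%:E).
  apply/integrableP; split.
    by apply/measurable_EFinP/measurable_indic; exact: measurable_box.
  rewrite (eq_integral (fun y => (\1_(@box R h n l) y)%:E)); last first.
    by move=> y _; rewrite gee0_abs// lee_fin.
  rewrite integral_indic//; last exact: measurable_box.
  by rewrite setIT [X in (X < _)%E](measure_box l) ltry.
transitivity (\int[mu]_y \sum_(l in H_k0 k n)
    ((moment_term k beta p q l)%:E * (\1_(@box R h n l) y)%:E))%E.
  by apply: eq_integral => y _; rewrite -sumEFin.
rewrite integral_sum//; last by move=> l; exact: integrableZl.
rewrite mulr_sumr -sumEFin; apply: eq_bigr => l _.
rewrite integralZl// integral_indic//; last exact: measurable_box.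
by rewrite setIT [X in (_ * X)%E = _](measure_box l) mulrC EFinM.
Qed.

Definition limit_on_plane (y : h.-tuple RT) : R :=
  if @hyperplane_pt R k y \in @Omega R k then moment_density (@hyperplane_pt R k y) else 0.

Lemma limit_on_planeE :
  (fun y => (limit_on_plane y)%:E) =
  (EFin \o moment_density \o @hyperplane_pt R k) \_ (@hyperplane_pt R k @^-1` @Omega R k).
Proof.
apply/funext => y; rewrite patchE /limit_on_plane /=.
have -> : (y \in @hyperplane_pt R k @^-1` @Omega R k) = (@hyperplane_pt R k y \in @Omega R k).
  by apply/idP/idP; rewrite !inE.
by case: ifP.
Qed.

Lemma measurable_preimage_Omega : measurable (@hyperplane_pt R k @^-1` @Omega R k).
Proof.
rewrite -[X in measurable X]setTI.
by apply: (@measurable_hyperplane_pt R k) => //; exact: measurable_Omega.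
Qed.

Lemma measurable_limit_on_plane : measurable_fun setT (EFin \o limit_on_plane).
Proof.
rewrite -[_ \o _]/(fun y => (limit_on_plane y)%:E) limit_on_planeE.
have m : measurable_fun setT (EFin \o moment_density \o @hyperplane_pt R k).
  apply: measurableT_comp; last exact: (@measurable_hyperplane_pt R k).
  by apply/measurable_EFinP; exact: measurable_moment_density.
apply/(measurable_restrictT _ measurable_preimage_Omega).
exact: (measurable_funS measurableT (@subsetT _ _) m).
Qed.

(** The bound on the step functions needs n >= k, hence the shift. *)
Lemma dominated_step_density :
  mu.-integrable setT (EFin \o limit_on_plane) /\
  (\int[mu]_y (step_density (n + k)%N y)%:E)%E @[n --> \oo] -->
    (\int[mu]_y (limit_on_plane y)%:E)%E.
Proof.
have [c cP] := step_density_bound q p beta0.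
have [] := @dominated_convergence _ _ R mu setT measurableT
  (fun n y => (step_density (n + k)%N y)%:E) (EFin \o limit_on_plane)
  (fun y => ((expR c)%:E * (laplace y)%:E)%E).
- by move=> n; apply/measurable_EFinP; exact: measurable_step_density.
- exact: measurable_limit_on_plane.
- apply: aeW => y _; apply: cvg_EFin; first by near=> n.
  have := @step_density_cvg R h beta q p beta0 y; rewrite -(cvg_shiftn k); exact.
- apply: integrableZl => //; apply/integrableP; split.
    by apply/measurable_EFinP; exact: measurable_laplace.
  rewrite (eq_integral (fun y => (laplace y)%:E)); first exact: integral_laplace.
  by move=> y _; rewrite gee0_abs// lee_fin expR_ge0.
- by apply: aeW => y n _; rewrite -EFinM abse_EFin lee_fin; apply: cP; rewrite leq_addl.
by move=> ? _ ?.
Unshelve. all: by end_near. Qed.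

Definition limit_moment : R := \int[lebesgue_hyperplane R k]_(x in Omega) moment_density x.

Lemma integral_limit_on_plane :
  (\int[mu]_y (limit_on_plane y)%:E = (limit_moment)%:E)%E.
Proof.
have [li _] := dominated_step_density.
have li' := li; rewrite -[_ \o _]/(fun y => (limit_on_plane y)%:E) limit_on_planeE in li'.
move/(integrable_mkcond _ measurable_preimage_Omega) : li' => li'.
have mf : measurable_fun setT (EFin \o moment_density).
  by apply/measurable_EFinP; exact: measurable_moment_density.
have E := @integral_pushforward _ _ _ _ R _ (@measurable_hyperplane_pt R k) mu
  (@Omega R k) _ mf li' (@measurable_Omega R k).
have fin := integrable_fin_num measurableT li.
rewrite /limit_moment /Rintegral.
have -> : (\int[lebesgue_hyperplane R k]_(x in Omega) (moment_density x)%:E)%E = _ := E.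
by rewrite integral_mkcond -limit_on_planeE fineK.
Qed.

Lemma riemann_sum_cvg :
  (fun n => (Num.sqrt (n + k)%:R)^-1 ^+ h *
     \sum_(l in H_k0 k (n + k)) moment_term k beta p q l) @ \oo --> limit_moment.
Proof.
have [_] := dominated_step_density; rewrite integral_limit_on_plane.
by under eq_fun do rewrite integral_step_density; move=> /fine_cvgP[].
Qed.

End fixed_exponent.

(** The corner of a unit cube on which the coordinates are positive and strictly
    decreasing; the last coordinate of the hyperplane, minus their sum, is then
    smaller than all of them. *)
Definition spread (j : 'I_h) : R := 2 * (h - j)%:R.

Lemma cube_decreasing (y : h.-tuple RT) :
    cube spread 1 y ->
  forall i j : 'I_k, (i < j)%N -> plane_coord y j < plane_coord y i.
Proof.
move=> yc i j ij.
have yb (a : 'I_h) : 2 * (h - a)%:R <= (tnth y a : R) < 2 * (h - a)%:R + 1.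
  by have := yc a; rewrite in_itv.
have y2 (a : 'I_h) : 2 <= (tnth y a : R).
  have /andP[+ _] := yb a; apply: le_trans.
  by rewrite ler_peMr// ler1n subn_gt0.
have ih : (i < h)%N by apply: leq_trans ij _; rewrite -ltnS.
have -> : i = widen_ord (leqnSn h) (Ordinal ih) by apply/val_inj.
rewrite plane_coord_widen; case: (unliftP ord_max j) => [a ja|->].
  have -> : j = widen_ord (leqnSn h) a.
    by rewrite ja; apply/val_inj; exact: lift_max.
  rewrite plane_coord_widen; have /andP[_ ya] := yb a; have /andP[+ _] := yb (Ordinal ih).
  apply: lt_le_trans; apply: (lt_le_trans ya) => /=.
  have ia : (i < a)%N by move: ij; rewrite ja lift_max.
  have -> : (h - i = h - a + (a - i))%N by have := ltn_ord a; lia.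
  rewrite natrD mulrDr lerD2l; have : 1 <= (a - i)%:R :> R by rewrite ler1n subn_gt0.
  by lra.
rewrite plane_coord_max (lt_le_trans _ (y2 _))// (@le_lt_trans _ _ 0)// oppr_le0.
by apply: sumr_ge0 => a _; rewrite (le_trans _ (y2 a)).
Qed.

Lemma limit_moment0_neq0 : limit_moment 0 != 0.
Proof.
apply/eqP => I0; have := integral_limit_on_plane 0; rewrite I0.
have f0 y : 0 <= limit_on_plane 0 y.
  rewrite /limit_on_plane; case: ifP => // _.
  by rewrite /moment_density expr0 mul1r powR_ge0.
have -> : (\int[mu]_y (limit_on_plane 0 y)%:E =
    \int[mu]_y `|(EFin \o limit_on_plane 0) y|)%E.
  by apply: eq_integral => y _; rewrite /= ger0_norm.
move/(ae_eq_integral_abs mu measurableT (measurable_limit_on_plane 0)).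
move=> [A [mA A0 sub]].
have cA : cube spread 1 `<=` A.
  move=> y yc; apply: sub => /= yA.
  have {yA} : limit_on_plane 0 y = 0 by apply: EFin_inj; exact: yA.
  have dec := cube_decreasing yc.
  rewrite /limit_on_plane ifT; last first.
    apply/mem_set; split; last exact: sum_plane_coord.
    move=> i j; rewrite leq_eqVlt => /orP[/eqP/val_inj ->//|ij].
    by apply/ltW/dec.
  rewrite /moment_density expr0 mul1r => /eqP; rewrite gt_eqF// powR_gt0//.
  rewrite mulr_gt0 ?expR_gt0//; apply: prodr_gt0 => i _; apply: prodr_gt0 => j ij.
  by rewrite subr_gt0; exact: dec.
have : (mu (cube spread 1) <= 0)%E.
  by rewrite -A0; apply: le_measure; rewrite ?inE//; exact: measurable_cube.
rewrite [X in (X <= _)%E](@lebesgue_tuple_cube R h _ 1)// expr1n lee_fin.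
by rewrite leNgt ltr01.
Qed.

End convergence.

Theorem theorem5p3 (R : realType) (k : nat) (hk : (2 <= k)%N)
    (beta : R) (hbeta : 0 < beta) (p : 'I_k) :
  (fun n : nat => cE beta k p n) @ \oo -->
    (\int[lebesgue_hyperplane R k]_(x in Omega) (tnth x p * weight beta x)) /
    (\int[lebesgue_hyperplane R k]_(x in Omega) weight beta x).
Proof.
case: k hk p => // h _ p.
have -> : \int[lebesgue_hyperplane R h.+1]_(x in Omega) (tnth x p * weight beta x) =
    limit_moment beta p 1.
  by apply: eq_Rintegral => x _; rewrite /moment_density expr1.
have -> : \int[lebesgue_hyperplane R h.+1]_(x in Omega) weight beta x = limit_moment beta p 0.
  by apply: eq_Rintegral => x _; rewrite /moment_density expr0 mul1r.
rewrite -(cvg_shiftn h.+1).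
have c1 := @riemann_sum_cvg R h beta p hbeta 1.
have c0 := @riemann_sum_cvg R h beta p hbeta 0.
have I0 := @limit_moment0_neq0 R h beta p hbeta.
pose S q n : R := (Num.sqrt (n + h.+1)%:R)^-1 ^+ h *
     \sum_(l in H_k0 h.+1 (n + h.+1)) moment_term h.+1 beta p q l.
have lim : (fun n => S 1 n / S 0 n) @ \oo --> limit_moment beta p 1 / limit_moment beta p 0.
  exact: cvgM c1 (cvgV I0 c0).
suff E : {near \oo, (fun n => S 1 n / S 0 n) =1
                    (fun n => cE beta h.+1 p (n + h.+1))}.
  by apply: cvg_trans lim; exact: near_eq_cvg.
have d0 : 0 < `|limit_moment beta p 0| by rewrite normr_gt0.
move/cvgrPdist_lt/(_ _ d0) : c0 => c0.
near=> n; have kn : (h.+1 <= n + h.+1)%N by rewrite leq_addl.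
have n0 : (0 < n + h.+1)%N by exact: leq_trans kn.
have [sn _ _] := sqrtn_facts R n0.
have dist : `|limit_moment beta p 0 - S 0 n| < `|limit_moment beta p 0|.
  by near: n.
have D0 : \sum_(l in H_k0 h.+1 (n + h.+1)) moment_term h.+1 beta p 0 l != 0.
  by apply/eqP => D0; move: dist; rewrite /S D0 mulr0 subr0 ltxx.
rewrite /S (cE_ratio _ kn D0)//; field.
by rewrite D0 expf_neq0// invr_neq0// gt_eqF.
Unshelve. all: by end_near. Qed.
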